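(* Let $a \in (0,1]$ and let $R_a = [-1,1]\times[-a,a]$. Let $\nu$ be the smallest positive solution of $\tan(\nu) = \coth(\nu a)$. Then the first nontrivial Steklov eigenvalue of $R_a$ is given by the eigenfunction $\sin(\nu x)\cosh(\nu y)$; that is, $\sigma_1(R_a) = \nu\tanh(\nu a)$.
   Context: For a bounded planar Lipschitz domain $\Omega$, a Steklov eigenvalue is a real number $\sigma$ for which there is a nonzero function $s$ (a Steklov eigenfunction) with $\Delta s = 0$ in $\Omega$ and $\partial_n s = \sigma s$ on $\partial\Omega$, where $\partial_n$ is the outward normal derivative (for a rectangle: the conditions hold on the open sides, or equivalently in the weak $H^1$ sense). The eigenvalues form a discrete sequence $0=\sigma_0<\sigma_1\le\sigma_2\le\cdots$, and $\sigma_1(\Omega)$ denotes the smallest nonzero (nontrivial) eigenvalue. *)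

(* Defs.v *)
From Stdlib Require Import Reals.
From Coquelicot Require Import Coquelicot.
Open Scope R_scope.

(** R_a = [-1,1] x [-a,a] and its interior. *)
Definition closed_rect (a : R) (p : R * R) : Prop :=
  -1 <= fst p <= 1 /\ -a <= snd p <= a.

Definition open_rect (a : R) (p : R * R) : Prop :=
  -1 < fst p < 1 /\ -a < snd p < a.

(** [outward_normal a x y nx ny]: the point (x,y) lies on one of the four open
    sides of R_a (corners excluded), and (nx,ny) is the unit outward normal there. *)
Inductive outward_normal (a : R) : R -> R -> R -> R -> Prop :=
| normal_right y : -a < y < a -> outward_normal a 1 y 1 0
| normal_left y : -a < y < a -> outward_normal a (-1) y (-1) 0
| normal_top x : -1 < x < 1 -> outward_normal a x a 0 1
| normal_bottom x : -1 < x < 1 -> outward_normal a x (-a) 0 (-1).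

(** The derivative is one-sided, from inside the rectangle, so that only the
    values of [s] on R_a matter. *)
Definition is_normal_derivative (s : R -> R -> R) (x y nx ny d : R) : Prop :=
  filterlim (fun h => (s x y - s (x - h * nx) (y - h * ny)) / h)
    (at_right 0) (locally d).

(** [ex_diff_n s 2] at every point of the open rectangle says that [s] is C^2 there. *)
Definition harmonic_in_rect (a : R) (s : R -> R -> R) : Prop :=
  forall x y, open_rect a (x, y) ->
    ex_diff_n s 2 x y /\
    partial_derive 2 0 s x y + partial_derive 0 2 s x y = 0.

(** The gradient of [s], taken in the open rectangle, extends continuously to
    every point of the open sides. *)
Definition gradient_extends_to_sides (a : R) (s : R -> R -> R) : Prop :=
  forall x y nx ny, outward_normal a x y nx ny ->
    (exists l : R,
      filterlim (fun p : R * R => partial_derive 1 0 s (fst p) (snd p))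
        (within (open_rect a) (locally (x, y))) (locally l)) /\
    (exists l : R,
      filterlim (fun p : R * R => partial_derive 0 1 s (fst p) (snd p))
        (within (open_rect a) (locally (x, y))) (locally l)).

(** Classical Steklov eigenfunctions: C^2 inside, C^1 up to the open sides and
    continuous on the closed rectangle. Nothing is asked of the derivatives at
    the corners; continuity there excludes the solutions of infinite Dirichlet
    energy (with a pole at a corner), which are not Steklov eigenfunctions. *)
Record steklov_eigenfunction (a sigma : R) (s : R -> R -> R) : Prop := {
  steklov_continuous :
    continuous_on (closed_rect a) (fun p : R * R => s (fst p) (snd p));
  steklov_C1 : gradient_extends_to_sides a s;
  steklov_nonzero : exists x y, closed_rect a (x, y) /\ s x y <> 0;
  steklov_harmonic : harmonic_in_rect a s;
  steklov_boundary : forall x y nx ny, outward_normal a x y nx ny ->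
    is_normal_derivative s x y nx ny (sigma * s x y)
}.

Definition steklov_eigenvalue (a sigma : R) : Prop :=
  exists s : R -> R -> R, steklov_eigenfunction a sigma s.

(** [sigma] is sigma_1(R_a), the smallest nonzero Steklov eigenvalue. *)
Definition is_first_nontrivial_steklov_eigenvalue (a sigma : R) : Prop :=
  steklov_eigenvalue a sigma /\ sigma <> 0 /\
  forall tau, steklov_eigenvalue a tau -> tau <> 0 -> sigma <= tau.

Definition coth (x : R) : R := cosh x / sinh x.

(** [cos t <> 0] says that [tan t] is defined. *)
Definition positive_solution (a t : R) : Prop :=
  0 < t /\ cos t <> 0 /\ tan t = coth (t * a).

Definition smallest_positive_solution (a nu : R) : Prop :=
  positive_solution a nu /\ forall t, positive_solution a t -> nu <= t.

(* Main.v *)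
Require Import Defs.
From Stdlib Require Import Reals Lra Classical ClassicalEpsilon List FunctionalExtensionality.
From Coquelicot Require Import Coquelicot.
Open Scope R_scope.

(** Let [s] be an eigenfunction with eigenvalue [tau <> 0], [tau < nu * tanh (nu * a)], and let
    [c > 0] be the even solution of [c'' = kappa c] with [c' = tau c] at [a]: [cosh (k y)] with
    [0 < k < nu] if [tau > 0], [cos (k y)] if [tau < 0]. On the prism [z <= y] the function
      W(x,y,z) = s(x,y) c(z) - s(x,z) c(y)
    solves [Delta W = kappa W], has normal derivative [tau W] on the faces [x = 1], [x = -1],
    [y = a] and [z = -a], and vanishes on [y = z]. The function
      cosh(nu x) (sin(nu y) c(z) - sin(nu z) c(y))
    solves the same equation, is positive for [z < y], and its normal derivatives on these faces
    exceed [tau] times its values, because [a <= 1]. After a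
    perturbation making it a strictly positive strict supersolution, with a logarithmic pole at
    the corners of the rectangle, where [s] is only continuous, the maximum principle for the
    quotient gives [W <= 0]. Applied to [s] and [- s] it gives [W = 0], that is
    [s(x,y) = f(x) c(y)], and the one-dimensional problem for [f] has no nonzero solution, by
    minimality of [nu]. *)

(** * Second derivatives at a maximum, compactness *)

(** The argument is pointwise: no energy identity or orthogonality is used, so the sign of [tau] is
    not free and negative [tau] needs a profile of its own. No maximum principle for [s] itself
    could help, since [s] has no sign; what can be compared is the defect of separation, a
    determinant that vanishes on the diagonal. The comparison function is the same determinant
    formed with [cosh (nu x) sin (nu y)], the expected eigenfunction with the two axes exchanged. On
    the square it is an eigenfunction for the same value [sigma = nu * tanh (nu * a)], so there all
    the slack on the faces comes from [tau < sigma]; for [a < 1] the shape of the rectangle adds to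
    it. In the prism the corners of the rectangle become edges, of codimension two, along which no
    normal derivative of [s] is known. A logarithm is the natural singularity in codimension two: it
    is infinite on the edges, yet an arbitrarily small multiple of it suffices. Since every
    inequality is made strict, first and second derivative tests at a contact point are enough. *)

Definition second_order_at (f : R -> R) (t l1 l2 : R) : Prop :=
  exists g : R -> R, locally t (fun u => is_derive f u (g u)) /\ g t = l1 /\ is_derive g t l2.

Lemma second_order_scal (k : R) (f : R -> R) (t l1 l2 : R) :
  second_order_at f t l1 l2 -> second_order_at (fun u => k * f u) t (k * l1) (k * l2).
Proof.
  intros [g [Hf [<- Hg]]]. exists (fun u => k * g u). split; [|split; [reflexivity|]].
  - revert Hf; apply filter_imp; intros u Hu.
    exact (is_derive_scal f u k (g u) Hu).
  - exact (is_derive_scal g t k l2 Hg).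
Qed.

Lemma second_order_plus (f g : R -> R) (t f1 f2 g1 g2 : R) :
  second_order_at f t f1 f2 -> second_order_at g t g1 g2 ->
  second_order_at (fun u => f u + g u) t (f1 + g1) (f2 + g2).
Proof.
  intros [f' [Hf [<- Hf']]] [g' [Hg [<- Hg']]].
  exists (fun u => f' u + g' u). split; [|split; [reflexivity|]].
  - generalize (filter_and _ _ Hf Hg); apply filter_imp; intros u [Hu Hv].
    exact (is_derive_plus f g u _ _ Hu Hv).
  - exact (is_derive_plus f' g' t _ _ Hf' Hg').
Qed.

Lemma second_order_ext (f g : R -> R) (t f1 f2 g1 g2 : R) :
  (forall u, f u = g u) -> f1 = g1 -> f2 = g2 ->
  second_order_at f t f1 f2 -> second_order_at g t g1 g2.
Proof.
  intros H <- <- [f' [Hf [E Hf']]]. exists f'. split; [|split]; auto.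
  revert Hf; apply filter_imp; intros u Hu. now apply is_derive_ext with f.
Qed.

Lemma second_order_intro (f f1 : R -> R) (t l2 : R) :
  locally t (fun u => is_derive f u (f1 u)) -> is_derive f1 t l2 ->
  second_order_at f t (f1 t) l2.
Proof. intros H1 H2. now exists f1. Qed.

Lemma second_order_is_derive (f : R -> R) (t l1 l2 : R) :
  second_order_at f t l1 l2 -> is_derive f t l1.
Proof. intros [g [Hf [<- _]]]. now apply locally_singleton in Hf. Qed.

Lemma second_order_reflect (f : R -> R) (t l1 l2 : R) :
  second_order_at f (- t) l1 l2 ->
  second_order_at (fun u => f (- u)) t (- l1) l2.
Proof.
  intros [g [Hf [<- Hg]]]. exists (fun u => - g (- u)). split; [|split; [reflexivity|]].
  - destruct Hf as [d Hd]. exists d. intros u Hu.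
    assert (H : is_derive f (- u) (g (- u))).
    { apply Hd. revert Hu. unfold ball; simpl; unfold AbsRing_ball, abs, minus, plus, opp; simpl.
      intros Hu. replace (- u + - - t) with (- (u + - t)) by ring. now rewrite Rabs_Ropp. }
    evar_last.
    + apply (is_derive_comp f (fun u => - u)); [exact H|].
      auto_derive; [easy|reflexivity].
    + simpl. unfold scal; simpl; unfold mult; simpl. ring.
  - evar_last.
    + apply (is_derive_opp (fun u => g (- u))).
      apply (is_derive_comp g (fun u => - u)); [exact Hg|].
      auto_derive; [easy|reflexivity].
    + simpl. unfold opp, scal; simpl; unfold mult; simpl. ring.
Qed.

Lemma locally_Rabs (t : R) (P : R -> Prop) :
  locally t P -> exists d, 0 < d /\ forall u, Rabs (u - t) < d -> P u.
Proof. intros [d Hd]. exists d. split; [apply cond_pos|]. intros u Hu. now apply Hd. Qed.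

(** If [l2] were positive, the derivative, zero at [t], would be positive just to the right of [t],
    and the mean value theorem would give a value above [f t]. *)
Lemma second_order_at_local_max (f : R -> R) (t l1 l2 : R) :
  second_order_at f t l1 l2 -> locally t (fun u => f u <= f t) -> l2 <= 0.
Proof.
  intros [g [Hf [_ Hg]]] Hm.
  apply Rnot_lt_le. intros Hl.
  destruct (locally_Rabs _ _ (filter_and _ _ Hf Hm)) as [d [Hd H]].
  assert (Ht : Rabs (t - t) < d) by (rewrite Rminus_diag, Rabs_R0; lra).
  assert (g0 : g t = 0).
  { assert (Hft : derivable_pt_lim f t (g t)) by (apply is_derive_Reals, H; auto).
    rewrite <- (derive_pt_eq_0 f t (g t) (exist _ (g t) Hft) Hft).
    apply deriv_maximum with (t - d) (t + d); try lra.
    intros u H1 H2. apply H. apply Rabs_def1; lra. }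
  apply is_derive_Reals in Hg.
  destruct (Hg (l2 / 2)) as [e He]; [lra|].
  set (h := Rmin d e / 2).
  assert (0 < Rmin d e) by (apply Rmin_pos; [lra|apply cond_pos]).
  assert (Rmin d e <= d) by apply Rmin_l. assert (Rmin d e <= e) by apply Rmin_r.
  destruct (MVT_cor2 f g t (t + h)) as [c [Hfc Hc]]; [unfold h; lra| |].
  { intros u Hu. apply is_derive_Reals, H, Rabs_def1; unfold h in *; lra. }
  assert (Hh : f (t + h) <= f t) by (apply H, Rabs_def1; unfold h; lra).
  assert (Hgc : Rabs ((g (t + (c - t)) - g t) / (c - t) - l2) < l2 / 2).
  { apply He; [lra|apply Rabs_def1; unfold h in *; lra]. }
  replace (t + (c - t)) with c in Hgc by ring.
  apply Rabs_def2 in Hgc. rewrite g0, Rminus_0_r in Hgc.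
  assert (0 < g c).
  { replace (g c) with (g c / (c - t) * (c - t)) by (field; lra).
    apply Rmult_lt_0_compat; lra. }
  assert (0 < g c * (t + h - t)) by (apply Rmult_lt_0_compat; unfold h; lra).
  lra.
Qed.

(** The factor [n] is the component of the outward normal along the line, so one statement serves
    both ends of an interval. *)
Lemma left_quotient_is_derive (f : R -> R) (t n l : R) :
  is_derive f t l ->
  filterlim (fun h => (f t - f (t - h * n)) / h) (at_right 0) (locally (n * l)).
Proof.
  intros Hf.
  assert (Hd : is_derive (fun h => - f (t - h * n)) 0 (n * l)).
  { evar_last.
    - apply (is_derive_opp (fun h => f (t - h * n))).
      apply (is_derive_comp f (fun h => t - h * n) 0 l).
      + replace (t - 0 * n) with t by ring. exact Hf.
      + auto_derive; [easy|reflexivity].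
    - simpl. unfold opp, scal; simpl; unfold mult; simpl. ring. }
  apply is_derive_Reals in Hd.
  apply filterlim_locally. intros e.
  destruct (Hd e (cond_pos e)) as [d H].
  exists d. intros h Hh Hh0. unfold ball; simpl; unfold AbsRing_ball, abs, minus, plus, opp; simpl.
  assert (H' : Rabs h < d).
  { revert Hh. unfold ball; simpl; unfold AbsRing_ball, abs, minus, plus, opp; simpl.
    now rewrite Ropp_0, Rplus_0_r. }
  specialize (H h (Rgt_not_eq _ _ Hh0) H'). revert H.
  rewrite Rplus_0_l, Rmult_0_l, Rminus_0_r.
  replace ((- f (t - h * n) - - f t) / h) with ((f t - f (t - h * n)) / h); [easy|].
  unfold Rdiv; ring.
Qed.

Lemma left_quotient_nonneg (f : R -> R) (v l : R) :
  filterlim (fun h => (v - f h) / h) (at_right 0) (locally l) ->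
  at_right 0 (fun h => f h <= v) -> 0 <= l.
Proof.
  intros Hl Hm.
  apply (filterlim_le (F := at_right 0) (fun _ => 0) (fun h => (v - f h) / h) 0 l).
  - assert (H0 : at_right 0 (fun h => 0 < h)) by now exists (mkposreal 1 Rlt_0_1).
    generalize (filter_and _ _ H0 Hm); apply filter_imp; intros h [Hh Hfh].
    apply Rmult_le_pos; [lra|]. now apply Rlt_le, Rinv_0_lt_compat.
  - apply filterlim_const.
  - exact Hl.
Qed.

Lemma at_right_0_intro (d : R) (P : R -> Prop) :
  0 < d -> (forall h, 0 < h < d -> P h) -> at_right 0 P.
Proof.
  intros Hd H. exists (mkposreal d Hd). intros h Hh Hh0. apply H. split; [easy|].
  revert Hh. unfold ball; simpl; unfold AbsRing_ball, abs, minus, plus, opp; simpl.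
  rewrite Ropp_0, Rplus_0_r. apply Rle_lt_trans, Rle_abs.
Qed.

Lemma locally_intro (t d : R) (P : R -> Prop) :
  0 < d -> (forall u, t - d < u < t + d -> P u) -> locally t P.
Proof.
  intros Hd H. exists (mkposreal d Hd). intros u Hu. apply H.
  revert Hu. unfold ball; simpl; unfold AbsRing_ball, abs, minus, plus, opp; simpl.
  intros Hu. apply Rabs_def2 in Hu. lra.
Qed.

Lemma filterlim_lincomb {T : Type} {F : (T -> Prop) -> Prop} {FF : Filter F}
  (f g : T -> R) (k1 k2 l1 l2 : R) :
  filterlim f F (locally l1) -> filterlim g F (locally l2) ->
  filterlim (fun h => k1 * f h + k2 * g h) F (locally (k1 * l1 + k2 * l2)).
Proof.
  intros Hf Hg.
  apply (filterlim_comp_2 (G := locally (k1 * l1)) (H := locally (k2 * l2))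
    (fun h => k1 * f h) (fun h => k2 * g h) Rplus).
  - exact (filterlim_comp _ _ _ f (Rmult k1) F _ _ Hf (filterlim_scal_r (V := R_NormedModule) k1 l1)).
  - exact (filterlim_comp _ _ _ g (Rmult k2) F _ _ Hg (filterlim_scal_r (V := R_NormedModule) k2 l2)).
  - exact (filterlim_plus (V := R_NormedModule) (k1 * l1) (k2 * l2)).
Qed.

(* Heine-Borel applied to the sets [f < f q], [q] in [K]. *)
Lemma max_on_compact_box (K : R * R * R -> Prop) (f : R * R * R -> R) (N : R) :
  (forall p, K p -> Rabs (fst (fst p)) <= N /\ Rabs (snd (fst p)) <= N /\ Rabs (snd p) <= N) ->
  closed K -> continuous_on K f -> (exists p, K p) ->
  exists p, K p /\ forall q, K q -> f q <= f p.
Proof.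
  intros Hbox Hcl Hc [p0 Hp0].
  apply NNPP. intros Hno.
  assert (Hstep : forall p, K p -> exists q, K q /\ f p < f q).
  { intros p Hp. apply NNPP. intros H. apply Hno. exists p. split; [easy|].
    intros q Hq. apply Rnot_lt_le. intros Hlt. apply H. now exists q. }
  set (pt := fun t : Compactness.Tn 3 R => (fst t, fst (snd t), fst (snd (snd t))) : R * R * R).
  assert (Hloc : forall t : Compactness.Tn 3 R, exists dq : (posreal * (R * R * R))%type,
    K (snd dq) /\
    forall u : Compactness.Tn 3 R, close_n 3 (fst dq) u t -> K (pt u) -> f (pt u) < f (snd dq)).
  { intros t.
    assert (H : exists q, K q /\ locally (pt t) (fun u => K u -> f u < f q)).
    { destruct (classic (K (pt t))) as [Ht|Ht].
      - destruct (Hstep _ Ht) as [q [Hq Hlt]]. exists q. split; [easy|].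
        apply (Hc _ Ht (fun v => v < f q)). now apply open_lt.
      (* Off the closed set [K] some neighbourhood misses [K], the claim is vacuous there, and [p0]
         is only a placeholder. *)
      - exists p0. split; [easy|].
        apply NNPP. intros H. apply Ht, Hcl. intros H'. apply H.
        revert H'. apply filter_imp. easy. }
    destruct H as [q [Hq [d Hd]]].
    exists (d, q). split; [easy|]. intros u Hu. apply Hd.
    destruct u as [u1 [u2 [u3 []]]], t as [t1 [t2 [t3 []]]].
    simpl in Hu. repeat split; unfold ball; simpl; unfold AbsRing_ball, abs, minus, plus, opp; simpl; apply Hu. }
  apply choice in Hloc. destruct Hloc as [dq Hdq].
  apply (compactness_list 3 (- N, (- N, (- N, tt))) (N, (N, (N, tt))) (fun t => fst (dq t))).
  intros [l Hl].
  assert (Hcov : forall q, K q -> exists t, In t l /\ f q < f (snd (dq t))).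
  { intros [[q1 q2] q3] Hq. destruct (Hl (q1, (q2, (q3, tt)))) as [t [Ht [_ Hct]]].
    - destruct (Hbox _ Hq) as [H1 [H2 H3]]. simpl in *.
      apply Rabs_le_between in H1, H2, H3. easy.
    - exists t. split; [easy|]. now apply (proj2 (Hdq t) (q1, (q2, (q3, tt)))). }
  assert (Hmax : forall l' : list (Compactness.Tn 3 R), l' <> nil ->
    exists t, In t l' /\ forall u, In u l' -> f (snd (dq u)) <= f (snd (dq t))).
  { induction l' as [|t l' IH]; [easy|]. intros _.
    destruct l' as [|t' l'].
    - exists t. split; [now left|]. intros u [->|[]]. lra.
    - destruct IH as [w [Hw Hwm]]; [easy|].
      destruct (Rle_dec (f (snd (dq t))) (f (snd (dq w)))) as [Hle|Hle].
      + exists w. split; [now right|]. intros u [<-|Hu]; [easy|now apply Hwm].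
      + exists t. split; [now left|]. intros u [<-|Hu]; [lra|].
        specialize (Hwm u Hu). lra. }
  destruct (Hmax l) as [t [Ht Htm]].
  { intros ->. destruct (Hcov _ Hp0) as [t [[] _]]. }
  destruct (Hcov (snd (dq t))) as [u [Hu Hlt]]; [apply Hdq|].
  specialize (Htm u Hu). lra.
Qed.

(** * A supersolution with poles at the corners *)

Lemma Derive_eta (f : R -> R) (x l : R) :
  is_derive f x l -> Derive (fun u : R => f u) x = l.
Proof. exact (is_derive_unique f x l). Qed.

Lemma second_order_exp_mult_comp (p q L p1 q1 L1 L2 : R -> R) (t p2 q2 : R) :
  (forall u, is_derive p u (p1 u)) -> is_derive p1 t p2 ->
  (forall u, is_derive q u (q1 u)) -> is_derive q1 t q2 ->
  (forall v, 0 < v -> is_derive L v (L1 v)) ->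
  (forall v, 0 < v -> is_derive L1 v (L2 v)) ->
  0 < q t ->
  second_order_at (fun u => exp (p u) * L (q u)) t
    (exp (p t) * (p1 t * L (q t) + L1 (q t) * q1 t))
    (exp (p t) * ((p2 + p1 t ^ 2) * L (q t) + 2 * p1 t * L1 (q t) * q1 t
                  + L2 (q t) * q1 t ^ 2 + L1 (q t) * q2)).
Proof.
  intros Hp Hp1 Hq Hq1 HL HL1 Ht.
  apply (second_order_intro (fun u => exp (p u) * L (q u))
           (fun u => exp (p u) * (p1 u * L (q u) + L1 (q u) * q1 u))).
  - assert (Hloc : locally t (fun u => 0 < q u)).
    { apply (ex_derive_continuous q t (ex_intro _ _ (Hq t)) (fun v => 0 < v)).
      now apply open_gt. }
    revert Hloc; apply filter_imp; intros u Hu.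
    evar_last.
    + auto_derive; [repeat split|reflexivity].
      * eexists; apply Hp. * eexists; now apply HL. * eexists; apply Hq.
    + rewrite (Derive_eta _ _ _ (Hp u)), (Derive_eta _ _ _ (Hq u)).
      rewrite (Derive_eta _ _ _ (HL _ Hu)). ring.
  - evar_last.
    + auto_derive; [|reflexivity].
      assert (ex_derive p t) by (eexists; apply Hp).
      assert (ex_derive q t) by (eexists; apply Hq).
      assert (ex_derive p1 t) by (eexists; apply Hp1).
      assert (ex_derive q1 t) by (eexists; apply Hq1).
      assert (ex_derive L (q t)) by (eexists; now apply HL).
      assert (ex_derive L1 (q t)) by (eexists; now apply HL1).
      tauto.
    + rewrite (Derive_eta _ _ _ (Hp t)), (Derive_eta _ _ _ (Hq t)).
      rewrite (Derive_eta _ _ _ (HL _ Ht)).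
      rewrite (Derive_eta _ _ _ (HL1 _ Ht)).
      rewrite (Derive_eta _ _ _ Hp1).
      rewrite (Derive_eta _ _ _ Hq1). ring.
Qed.

(* Equivalent to the squared distance to (1,a) near (1,a) and to (-1,a) near (-1,a); its
   normal derivative vanishes on the sides x = 1, x = -1 and y = a, because (1 - x^2)/2
   vanishes at both ends. *)
Definition corner_dist2 (a x y : R) : R := ((1 - x ^ 2) / 2) ^ 2 + (a - y) ^ 2.

(** With [r = sqrt q] this is [3 + 3 K - ln r - K r], the logarithmic pole of the plane Laplacian
    with a correction. For [K >= 0] the constant keeps it positive as long as [q <= 5], because then
    [ln q / 2 <= 2] and [sqrt q <= 3]. *)
Definition log_profile (K q : R) : R := 3 + 3 * K - ln q / 2 - K * sqrt q.
Definition log_profile_d1 (K q : R) : R := - / (2 * q) - K / (2 * sqrt q).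
Definition log_profile_d2 (K q : R) : R := / (2 * q ^ 2) + K / (4 * (q * sqrt q)).

(** Sum of bounds for coefficients of [1 / r]: [2 B^2 + B] from the second derivatives of the
    exponential, [4 B] from the cross terms, and [3] because [ln q] is only approximately
    harmonic. *)
Definition barrier_coef (B : R) : R := 2 * B ^ 2 + 5 * B + 3.

(* The exponential has normal derivative at least [B] times itself on the three sides near
   the corners. The term - K r of the profile has Laplacian about - K / r near a corner, which
   for this [K] absorbs all the other terms of the Laplacian of the product. *)
Definition corner_barrier (a B x y : R) : R :=
  exp (B * x ^ 2 / 2 + B * y) * log_profile (barrier_coef B) (corner_dist2 a x y).

Lemma is_derive_log_profile (K q : R) :
  0 < q -> is_derive (log_profile K) q (log_profile_d1 K q).
Proof.
  intros Hq. unfold log_profile, log_profile_d1.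
  assert (0 < sqrt q) by now apply sqrt_lt_R0.
  auto_derive; [easy|]. field. lra.
Qed.

Lemma is_derive_log_profile_d1 (K q : R) :
  0 < q -> is_derive (log_profile_d1 K) q (log_profile_d2 K q).
Proof.
  intros Hq. unfold log_profile_d1, log_profile_d2.
  assert (0 < sqrt q) by now apply sqrt_lt_R0.
  assert (Hs : sqrt q * sqrt q = q) by (apply sqrt_sqrt; lra).
  auto_derive; [repeat split; lra|].
  set (r := sqrt q) in *. clearbody r. subst q. field. lra.
Qed.

Definition corner_barrier_dx (a B x y : R) : R :=
  exp (B * x ^ 2 / 2 + B * y) *
  (B * x * log_profile (barrier_coef B) (corner_dist2 a x y)
   + log_profile_d1 (barrier_coef B) (corner_dist2 a x y) * (- (x * (1 - x ^ 2)))).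

Definition corner_barrier_dxx (a B x y : R) : R :=
  exp (B * x ^ 2 / 2 + B * y) *
  ((B + (B * x) ^ 2) * log_profile (barrier_coef B) (corner_dist2 a x y)
   + 2 * (B * x) * log_profile_d1 (barrier_coef B) (corner_dist2 a x y) * (- (x * (1 - x ^ 2)))
   + log_profile_d2 (barrier_coef B) (corner_dist2 a x y) * (- (x * (1 - x ^ 2))) ^ 2
   + log_profile_d1 (barrier_coef B) (corner_dist2 a x y) * (3 * x ^ 2 - 1)).

Definition corner_barrier_dy (a B x y : R) : R :=
  exp (B * x ^ 2 / 2 + B * y) *
  (B * log_profile (barrier_coef B) (corner_dist2 a x y)
   + log_profile_d1 (barrier_coef B) (corner_dist2 a x y) * (- 2 * (a - y))).

Definition corner_barrier_dyy (a B x y : R) : R :=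
  exp (B * x ^ 2 / 2 + B * y) *
  ((0 + B ^ 2) * log_profile (barrier_coef B) (corner_dist2 a x y)
   + 2 * B * log_profile_d1 (barrier_coef B) (corner_dist2 a x y) * (- 2 * (a - y))
   + log_profile_d2 (barrier_coef B) (corner_dist2 a x y) * (- 2 * (a - y)) ^ 2
   + log_profile_d1 (barrier_coef B) (corner_dist2 a x y) * 2).

Lemma corner_barrier_second_order_x (a B x y : R) :
  0 < corner_dist2 a x y ->
  second_order_at (fun u => corner_barrier a B u y) x
    (corner_barrier_dx a B x y) (corner_barrier_dxx a B x y).
Proof.
  intros HQ. unfold corner_barrier, corner_barrier_dx, corner_barrier_dxx.
  apply (second_order_exp_mult_comp (fun u => B * u ^ 2 / 2 + B * y)
    (fun u => corner_dist2 a u y) _ (fun u => B * u) (fun u => - (u * (1 - u ^ 2)))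
    _ (log_profile_d2 (barrier_coef B))); [| | | | | |exact HQ].
  - intros u. auto_derive; [easy|]. simpl; field.
  - auto_derive; [easy|]. ring.
  - intros u. unfold corner_dist2. auto_derive; [easy|]. simpl; field.
  - auto_derive; [easy|]. simpl; ring.
  - apply is_derive_log_profile.
  - apply is_derive_log_profile_d1.
Qed.

Lemma corner_barrier_second_order_y (a B x y : R) :
  0 < corner_dist2 a x y ->
  second_order_at (fun u => corner_barrier a B x u) y
    (corner_barrier_dy a B x y) (corner_barrier_dyy a B x y).
Proof.
  intros HQ. unfold corner_barrier, corner_barrier_dy, corner_barrier_dyy.
  apply (second_order_exp_mult_comp (fun u => B * x ^ 2 / 2 + B * u)
    (fun u => corner_dist2 a x u) _ (fun u => B) (fun u => - 2 * (a - u))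
    _ (log_profile_d2 (barrier_coef B))); [| | | | | |exact HQ].
  - intros u. auto_derive; [easy|]. simpl; field.
  - auto_derive; [easy|]. ring.
  - intros u. unfold corner_dist2. auto_derive; [easy|]. simpl; field.
  - auto_derive; [easy|]. simpl; ring.
  - apply is_derive_log_profile.
  - apply is_derive_log_profile_d1.
Qed.

Lemma corner_barrier_dx_side (a B x y : R) :
  x ^ 2 = 1 -> corner_barrier_dx a B x y = x * (B * corner_barrier a B x y).
Proof.
  intros Hx. unfold corner_barrier_dx, corner_barrier. rewrite Hx. ring.
Qed.

Lemma corner_barrier_dy_top (a B x : R) :
  corner_barrier_dy a B x a = B * corner_barrier a B x a.
Proof. unfold corner_barrier_dy, corner_barrier. ring. Qed.

Lemma sqr_le_1 (x : R) : -1 <= x <= 1 -> 0 <= x ^ 2 <= 1.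
Proof. nra. Qed.

Lemma corner_dist2_le (a x y : R) :
  a <= 1 -> -1 <= x <= 1 -> -a <= y <= a -> corner_dist2 a x y <= 5.
Proof.
  intros Ha Hx Hy. unfold corner_dist2. apply sqr_le_1 in Hx. nra.
Qed.

Lemma ln_le_pred (q : R) : 0 < q -> ln q <= q - 1.
Proof.
  intros Hq. generalize (exp_ineq1_le (ln q)). rewrite exp_ln; lra.
Qed.

Lemma log_profile_bounds (a B x y : R) :
  a <= 1 -> 0 <= B -> -1 <= x <= 1 -> -a <= y <= a -> 0 < corner_dist2 a x y ->
  0 < log_profile (barrier_coef B) (corner_dist2 a x y) /\
  - ln (corner_dist2 a x y) / 2 <= log_profile (barrier_coef B) (corner_dist2 a x y).
Proof.
  intros Ha HB Hx Hy HQ.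
  assert (HQ5 := corner_dist2_le a x y Ha Hx Hy).
  set (q := corner_dist2 a x y) in *.
  assert (Hl := ln_le_pred q HQ).
  assert (Hs : sqrt q <= 3).
  { rewrite <- (sqrt_square 3) by lra. apply sqrt_le_1; lra. }
  assert (HK : 0 <= barrier_coef B) by (unfold barrier_coef; nra).
  assert (barrier_coef B * sqrt q <= barrier_coef B * 3) by (apply Rmult_le_compat_l; lra).
  unfold log_profile. lra.
Qed.

Lemma corner_barrier_nonneg (a B x y : R) :
  a <= 1 -> 0 <= B -> -1 <= x <= 1 -> -a <= y <= a -> 0 < corner_dist2 a x y ->
  0 <= corner_barrier a B x y.
Proof.
  intros Ha HB Hx Hy HQ.
  apply Rmult_le_pos; [apply Rlt_le, exp_pos|].
  apply Rlt_le, (log_profile_bounds a B x y); assumption.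
Qed.

(** The exponent is at least [- B], since [y >= - a >= -1]. This gives an explicit rate for the
    blow-up at the corners. *)
Lemma corner_barrier_ge_ln (a B x y : R) :
  a <= 1 -> 0 <= B -> -1 <= x <= 1 -> -a <= y <= a -> 0 < corner_dist2 a x y ->
  corner_dist2 a x y <= 1 ->
  exp (- B) * (- ln (corner_dist2 a x y) / 2) <= corner_barrier a B x y.
Proof.
  intros Ha HB Hx Hy HQ HQ1.
  assert (Hl := ln_le_pred _ HQ).
  unfold corner_barrier. apply Rmult_le_compat.
  - apply Rlt_le, exp_pos.
  - lra.
  - assert (Hx2 := sqr_le_1 x Hx).
    assert (- B <= B * x ^ 2 / 2 + B * y) by nra.
    destruct (Rle_lt_or_eq_dec _ _ H) as [Hlt|<-]; [|lra].
    now apply Rlt_le, exp_increasing.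
  - now apply log_profile_bounds.
Qed.

(** Expand in powers of [i = 1 / r]. The terms in [i^2] cancel up to a factor [xi <= r], as they do
    for the logarithm of a Euclidean distance; the terms in [i] then add up to at most
    [(2 B^2 + 5 B + 3 - K) i = 0]. Only bounded terms remain, even at the corners. *)
Lemma corner_barrier_laplacian_le (a B : R) :
  a <= 1 -> 0 <= B -> exists M, 0 <= M /\
  forall x y, -1 <= x <= 1 -> -a <= y <= a -> 0 < corner_dist2 a x y ->
  corner_barrier_dxx a B x y + corner_barrier_dyy a B x y <= M.
Proof.
  intros Ha HB.
  set (K := barrier_coef B).
  assert (HK : 0 <= K) by (unfold K, barrier_coef; nra).
  (* The bounded parts of the estimates [T1], [T2] and [T3] below, in this order. *)
  set (M := (2 * B ^ 2 + B) * (3 + 3 * K) + 4 * B * K + 3 * K).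
  assert (HM : 0 <= M) by (unfold M; nra).
  exists (exp (2 * B) * M). split.
  { apply Rmult_le_pos; [apply Rlt_le, exp_pos|exact HM]. }
  intros x y Hx Hy HQ.
  assert (Hx2 := sqr_le_1 x Hx).
  set (E := (B ^ 2 * x ^ 2 + B + B ^ 2) * log_profile K (corner_dist2 a x y)
    + 2 * B * log_profile_d1 K (corner_dist2 a x y) * (- x ^ 2 * (1 - x ^ 2) - 2 * (a - y))
    + (log_profile_d2 K (corner_dist2 a x y) * (x ^ 2 * (1 - x ^ 2) ^ 2 + 4 * (a - y) ^ 2)
       + log_profile_d1 K (corner_dist2 a x y) * (3 * x ^ 2 + 1))).
  apply Rle_trans with (exp (B * x ^ 2 / 2 + B * y) * E).
  { right. unfold corner_barrier_dxx, corner_barrier_dyy, E, K. ring. }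
  assert (HE : E <= M).
  { set (xi := (1 - x ^ 2) / 2). set (ze := a - y).
    assert (Hxi : 0 <= xi <= 1 / 2) by (unfold xi; lra).
    assert (Hze : 0 <= ze) by (unfold ze; lra).
    assert (Hx2xi : x ^ 2 = 1 - 2 * xi) by (unfold xi; field).
    set (r := sqrt (corner_dist2 a x y)).
    assert (Hr : 0 < r) by now apply sqrt_lt_R0.
    assert (Hrr : r * r = corner_dist2 a x y) by (apply sqrt_sqrt; lra).
    assert (Hr2 : r * r = xi * xi + ze * ze) by (rewrite Hrr; unfold corner_dist2, xi, ze; ring).
    assert (Hxir : xi <= r) by nra.
    assert (Hzer : ze <= r) by nra.
    set (i := / r).
    assert (Hi : 0 < i) by now apply Rinv_0_lt_compat.
    assert (Hri : r * i = 1) by (apply Rinv_r; lra).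
    (* The inequality [- ln r = ln i <= i - 1] trades the logarithm for the power of [r] that the
       correction absorbs. *)
    assert (HL : log_profile K (corner_dist2 a x y) <= 3 + 3 * K + i).
    { unfold log_profile. fold r. rewrite <- Hrr, ln_mult by lra.
      assert (Hl := ln_le_pred i Hi). unfold i in Hl at 1. rewrite ln_Rinv in Hl by lra.
      assert (0 <= K * r) by (apply Rmult_le_pos; lra). lra. }
    assert (HL1 : log_profile_d1 K (corner_dist2 a x y) = - (i ^ 2 / 2) - K * i / 2).
    { unfold log_profile_d1. fold r. rewrite <- Hrr. unfold i. field. lra. }
    assert (HL2 : log_profile_d2 K (corner_dist2 a x y) = i ^ 4 / 2 + K * i ^ 3 / 4).
    { unfold log_profile_d2. fold r. rewrite <- Hrr. unfold i. field. lra. }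
    assert (Hp : 0 <= xi * i <= 1) by nra.
    assert (Hz : 0 <= ze * i <= 1) by nra.
    assert (T1 : (B ^ 2 * x ^ 2 + B + B ^ 2) * log_profile K (corner_dist2 a x y)
                 <= (2 * B ^ 2 + B) * (3 + 3 * K + i)).
    { assert (0 <= B ^ 2) by nra.
      apply Rle_trans with ((B ^ 2 * x ^ 2 + B + B ^ 2) * (3 + 3 * K + i)).
      - apply Rmult_le_compat_l; [nra|exact HL].
      - apply Rmult_le_compat_r; nra. }
    assert (T2 : 2 * B * log_profile_d1 K (corner_dist2 a x y)
                   * (- x ^ 2 * (1 - x ^ 2) - 2 * (a - y)) <= 4 * B * i + 4 * B * K).
    { rewrite HL1. replace (1 - x ^ 2) with (2 * xi) by (unfold xi; field). fold ze.
      replace (2 * B * (- (i ^ 2 / 2) - K * i / 2) * (- x ^ 2 * (2 * xi) - 2 * ze))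
        with (2 * B * ((i + K) * (x ^ 2 * (xi * i) + ze * i))) by field.
      assert (0 <= x ^ 2 * (xi * i) <= 1) by nra.
      assert ((i + K) * (x ^ 2 * (xi * i) + ze * i) <= (i + K) * 2)
        by (apply Rmult_le_compat_l; lra).
      nra. }
    assert (T3 : log_profile_d2 K (corner_dist2 a x y) * (x ^ 2 * (1 - x ^ 2) ^ 2 + 4 * (a - y) ^ 2)
       + log_profile_d1 K (corner_dist2 a x y) * (3 * x ^ 2 + 1) <= 3 * i + K * (3 - i)).
    { rewrite HL1, HL2, Hx2xi. fold ze.
      (* The squared gradient of [corner_dist2] is four times [corner_dist2], as for a squared
         distance, up to a cubic term of favourable sign. *)
      replace ((1 - 2 * xi) * (1 - (1 - 2 * xi)) ^ 2 + 4 * ze ^ 2)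
        with (4 * (r * r) - 8 * xi ^ 3) by (rewrite Hr2; ring).
      replace ((i ^ 4 / 2 + K * i ^ 3 / 4) * (4 * (r * r) - 8 * xi ^ 3))
        with (2 * (r * i) ^ 2 * i ^ 2 + K * (r * i) ^ 2 * i
              - (4 * xi ^ 3 * i ^ 4 + 2 * K * xi ^ 3 * i ^ 3)) by field.
      rewrite Hri.
      assert (0 <= 4 * xi ^ 3 * i ^ 4) by (repeat apply Rmult_le_pos; try apply pow_le; lra).
      assert (0 <= 2 * K * xi ^ 3 * i ^ 3) by (repeat apply Rmult_le_pos; try apply pow_le; lra).
      assert (0 <= K * (1 - xi * i)) by (apply Rmult_le_pos; lra).
      assert (0 <= i * (1 - xi * i)) by (apply Rmult_le_pos; lra).
      nra. }
    unfold E.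
    assert (Kval : K = 2 * B ^ 2 + 5 * B + 3) by reflexivity.
    assert (i * K = i * (2 * B ^ 2 + 5 * B + 3)) by now rewrite Kval.
    unfold M. nra. }
  apply Rle_trans with (exp (B * x ^ 2 / 2 + B * y) * M).
  - apply Rmult_le_compat_l; [apply Rlt_le, exp_pos|exact HE].
  - apply Rmult_le_compat_r; [exact HM|].
    assert (B * x ^ 2 / 2 + B * y <= 2 * B) by nra.
    destruct (Rle_lt_or_eq_dec _ _ H) as [Hlt| ->]; [|lra].
    now apply Rlt_le, exp_increasing.
Qed.

(** * The two-point maximum principle *)

(** Second derivatives are taken along coordinate lines, the form in which the test at a maximum
    uses them. The class is closed under negation, so that upper bounds also yield lower bounds. *)
Record steklov_solution (a tau : R) (s : R -> R -> R) : Prop := {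
  solution_continuous :
    continuous_on (closed_rect a) (fun p : R * R => s (fst p) (snd p));
  solution_harmonic : forall x y, open_rect a (x, y) ->
    exists p pxx q qyy, second_order_at (fun u => s u y) x p pxx /\
      second_order_at (fun u => s x u) y q qyy /\ pxx + qyy = 0;
  solution_boundary : forall x y nx ny, outward_normal a x y nx ny ->
    is_normal_derivative s x y nx ny (tau * s x y)
}.

(** Exchanging [y] and [z] changes the sign of [two_point], so one half of the product domain
    carries all the information, and the diagonal becomes a face with zero boundary values. *)
Definition prism (a x y z : R) : Prop := -1 <= x <= 1 /\ -a <= z <= y /\ y <= a.

(** Removes the edges where [(x, y)] is a top corner or [(x, z)] is a bottom corner; the second case
    is reflected to the first, hence [- z]. *)
Definition off_corners (a x y z : R) : Prop :=
  0 < corner_dist2 a x y /\ 0 < corner_dist2 a x (- z).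

Definition two_point (s : R -> R -> R) (c : R -> R) (x y z : R) : R :=
  s x y * c z - s x z * c y.

(* [two_point s c] satisfies these relations with equality. No condition is needed on the
   face y = z of the prism, where [two_point s c] vanishes. *)
Definition strict_supersolution (a tau kappa : R) (Phi : R -> R -> R -> R) (x y z : R) : Prop :=
  exists p1 p11 p2 p22 p3 p33,
    second_order_at (fun u => Phi u y z) x p1 p11 /\
    second_order_at (fun u => Phi x u z) y p2 p22 /\
    second_order_at (fun u => Phi x y u) z p3 p33 /\
    p11 + p22 + p33 < kappa * Phi x y z /\
    (x ^ 2 = 1 -> tau * Phi x y z < x * p1) /\
    (y = a -> tau * Phi x y z < p2) /\
    (z = - a -> tau * Phi x y z < - p3).

(** Let [W] be [two_point s c]. At the contact point [W - m Phi] has a local maximum with value 0.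
    On a face its outward derivative is nonnegative, but it is also less than [tau (W - m Phi) = 0].
    Inside, its Laplacian is at most 0, but it is also greater than [kappa (W - m Phi) = 0]. *)
Lemma no_contact (a tau kappa : R) (s : R -> R -> R) (c c1 : R -> R)
  (Phi : R -> R -> R -> R) (m d x y z : R) :
  steklov_solution a tau s ->
  (forall u, is_derive c u (c1 u)) -> (forall u, is_derive c1 u (kappa * c u)) ->
  c1 a = tau * c a -> c1 (- a) = - tau * c (- a) ->
  0 < m -> 0 < d -> prism a x y z -> z < y -> off_corners a x y z ->
  strict_supersolution a tau kappa Phi x y z ->
  two_point s c x y z = m * Phi x y z ->
  (forall x' y' z', prism a x' y' z' ->
    Rabs (x' - x) < d -> Rabs (y' - y) < d -> Rabs (z' - z) < d ->
    two_point s c x' y' z' <= m * Phi x' y' z') ->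
  False.
Proof.
  intros Hs Hc Hc1 Hca Hcma Hm Hd [Hx [[Hz1 Hz2] Hy]] Hzy [HQ1 HQ2]
    [p1 [p11 [p2 [p22 [p3 [p33 [S1 [S2 [S3 [Hlap [Hbx [Hby Hbz]]]]]]]]]]]] Heq Hmax.
  assert (Hd0 : Rabs 0 < d) by (rewrite Rabs_R0; lra).
  assert (Hside : x ^ 2 = 1 -> False).
  { intros Hx1.
    (* Off the corners, [x^2 = 1] puts both [(x, y)] and [(x, z)] on an open side, where the normal
       derivative of [s] is prescribed. *)
    assert (Hyz : -a < y < a /\ -a < z < a).
    { unfold corner_dist2 in HQ1, HQ2. rewrite Hx1 in HQ1, HQ2.
      assert (y <> a) by (intros ->; lra). assert (z <> - a) by (intros ->; lra). lra. }
    destruct Hyz as [Hy' Hz'].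
    assert (Hxn : x = 1 \/ x = -1) by nra.
    assert (Hn : forall v, -a < v < a -> outward_normal a x v x 0).
    { intros v Hv. destruct Hxn as [->| ->]; now constructor. }
    assert (L1 := solution_boundary _ _ _ Hs _ _ _ _ (Hn y Hy')).
    assert (L2 := solution_boundary _ _ _ Hs _ _ _ _ (Hn z Hz')).
    assert (L3 := left_quotient_is_derive _ _ x _ (second_order_is_derive _ _ _ _ S1)).
    assert (H0 : 0 <= 1 * (c z * (tau * s x y) + - c y * (tau * s x z)) + - m * (x * p1)).
    { apply (left_quotient_nonneg
        (fun h => two_point s c (x - h * x) y z - m * Phi (x - h * x) y z) 0).
      - eapply filterlim_ext; [|exact (filterlim_lincomb _ _ 1 (- m) _ _
          (filterlim_lincomb _ _ (c z) (- c y) _ _ L1 L2) L3)].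
        intros h. simpl. rewrite !Rmult_0_r, !Rminus_0_r.
        replace (0 - (two_point s c (x - h * x) y z - m * Phi (x - h * x) y z))
          with (two_point s c x y z - m * Phi x y z
                - (two_point s c (x - h * x) y z - m * Phi (x - h * x) y z)) by lra.
        unfold two_point, Rdiv. ring.
      - apply at_right_0_intro with (Rmin d 1); [now apply Rmin_pos; lra|].
        intros h [Hh1 Hh2]. apply Rmin_Rgt_l in Hh2.
        enough (two_point s c (x - h * x) y z <= m * Phi (x - h * x) y z) by lra.
        apply Hmax.
        + unfold prism. destruct Hxn as [->| ->]; repeat split; lra.
        + apply Rabs_def1; destruct Hxn as [->| ->]; lra.
        + now rewrite Rminus_diag.
        + now rewrite Rminus_diag. }
    assert (Hp := Rmult_lt_compat_l _ _ _ Hm (Hbx Hx1)).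
    apply (Rmult_eq_compat_l tau) in Heq. unfold two_point in Heq. lra. }
  assert (Hx' : -1 < x < 1).
  { assert (x <> 1) by (intros ->; apply Hside; ring).
    assert (x <> -1) by (intros ->; apply Hside; ring). lra. }
  assert (Htop : y <> a).
  { intros ->.
    assert (L1 := solution_boundary _ _ _ Hs _ _ _ _ (normal_top a x Hx')).
    assert (L2 := left_quotient_is_derive _ _ 1 _ (Hc a)).
    assert (L3 := left_quotient_is_derive _ _ 1 _ (second_order_is_derive _ _ _ _ S2)).
    assert (H0 : 0 <= 1 * (c z * (tau * s x a) + - s x z * (1 * c1 a)) + - m * (1 * p2)).
    { apply (left_quotient_nonneg
        (fun h => two_point s c x (a - h * 1) z - m * Phi x (a - h * 1) z) 0).
      - eapply filterlim_ext; [|exact (filterlim_lincomb _ _ 1 (- m) _ _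
          (filterlim_lincomb _ _ (c z) (- s x z) _ _ L1 L2) L3)].
        intros h. simpl. rewrite !Rmult_0_r, !Rminus_0_r.
        replace (0 - (two_point s c x (a - h * 1) z - m * Phi x (a - h * 1) z))
          with (two_point s c x a z - m * Phi x a z
                - (two_point s c x (a - h * 1) z - m * Phi x (a - h * 1) z)) by lra.
        unfold two_point, Rdiv. ring.
      (* A displacement below [a - z] keeps the point on the right side of the diagonal. *)
      - apply at_right_0_intro with (Rmin d (a - z)); [apply Rmin_pos; lra|].
        intros h [Hh1 Hh2]. apply Rmin_Rgt_l in Hh2.
        enough (two_point s c x (a - h * 1) z <= m * Phi x (a - h * 1) z) by lra.
        apply Hmax.
        + unfold prism. repeat split; lra.
        + now rewrite Rminus_diag.
        + apply Rabs_def1; lra.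
        + now rewrite Rminus_diag. }
    assert (Hp := Rmult_lt_compat_l _ _ _ Hm (Hby eq_refl)).
    apply (Rmult_eq_compat_l tau) in Heq. unfold two_point in Heq. rewrite Hca in H0. lra. }
  assert (Hbot : z <> - a).
  { intros ->.
    assert (L1 := solution_boundary _ _ _ Hs _ _ _ _ (normal_bottom a x Hx')).
    assert (L2 := left_quotient_is_derive _ _ (-1) _ (Hc (- a))).
    assert (L3 := left_quotient_is_derive _ _ (-1) _ (second_order_is_derive _ _ _ _ S3)).
    assert (H0 : 0 <= 1 * (s x y * (-1 * c1 (- a)) + - c y * (tau * s x (- a))) + - m * (-1 * p3)).
    { apply (left_quotient_nonneg
        (fun h => two_point s c x y (- a - h * -1) - m * Phi x y (- a - h * -1)) 0).
      - eapply filterlim_ext; [|exact (filterlim_lincomb _ _ 1 (- m) _ _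
          (filterlim_lincomb _ _ (s x y) (- c y) _ _ L2 L1) L3)].
        intros h. simpl. rewrite !Rmult_0_r, !Rminus_0_r.
        replace (0 - (two_point s c x y (- a - h * -1) - m * Phi x y (- a - h * -1)))
          with (two_point s c x y (- a) - m * Phi x y (- a)
                - (two_point s c x y (- a - h * -1) - m * Phi x y (- a - h * -1))) by lra.
        unfold two_point, Rdiv. ring.
      - apply at_right_0_intro with (Rmin d (y + a)); [apply Rmin_pos; lra|].
        intros h [Hh1 Hh2]. apply Rmin_Rgt_l in Hh2.
        enough (two_point s c x y (- a - h * -1) <= m * Phi x y (- a - h * -1)) by lra.
        apply Hmax.
        + unfold prism. repeat split; lra.
        + now rewrite Rminus_diag.
        + now rewrite Rminus_diag.
        + apply Rabs_def1; lra. }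
    assert (Hp := Rmult_lt_compat_l _ _ _ Hm (Hbz eq_refl)).
    apply (Rmult_eq_compat_l tau) in Heq. unfold two_point in Heq. rewrite Hcma in H0. lra. }
  destruct (solution_harmonic _ _ _ Hs x y) as [sy1 [sy11 [sy2 [sy22 [Y1 [Y2 HY]]]]]].
  { split; simpl; lra. }
  destruct (solution_harmonic _ _ _ Hs x z) as [sz1 [sz11 [sz2 [sz22 [Z1 [Z2 HZ]]]]]].
  { split; simpl; lra. }
  assert (Dc : forall v, second_order_at c v (c1 v) (kappa * c v)).
  { intros v. apply second_order_intro; [|apply Hc1]. now apply filter_forall. }
  (* The point is now interior to the prism, so each coordinate can move both ways. The sum of [D1],
     [D2] and [D3] is the sign of the Laplacian of [two_point s c - m Phi]. *)
  assert (D1 : c z * sy11 + - c y * sz11 + - m * p11 <= 0).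
  { apply (second_order_at_local_max (fun u => c z * s u y + - c y * s u z + - m * Phi u y z) x
      (c z * sy1 + - c y * sz1 + - m * p1)).
    - apply second_order_plus; [apply second_order_plus|]; apply second_order_scal; auto.
    - apply locally_intro with (Rmin d (Rmin (1 - x) (1 + x))).
      { repeat apply Rmin_pos; lra. }
      intros u Hu.
      assert (Rmin d (Rmin (1 - x) (1 + x)) <= d) by apply Rmin_l.
      assert (Rmin d (Rmin (1 - x) (1 + x)) <= Rmin (1 - x) (1 + x)) by apply Rmin_r.
      assert (Rmin (1 - x) (1 + x) <= 1 - x) by apply Rmin_l.
      assert (Rmin (1 - x) (1 + x) <= 1 + x) by apply Rmin_r.
      assert (Hu' : two_point s c u y z <= m * Phi u y z).
      { apply Hmax; [unfold prism; repeat split; lra|apply Rabs_def1; lra| |];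
          now rewrite Rminus_diag. }
      unfold two_point in Hu', Heq. lra. }
  assert (D2 : c z * sy22 + - s x z * (kappa * c y) + - m * p22 <= 0).
  { apply (second_order_at_local_max (fun u => c z * s x u + - s x z * c u + - m * Phi x u z) y
      (c z * sy2 + - s x z * c1 y + - m * p2)).
    - apply second_order_plus; [apply second_order_plus|]; apply second_order_scal; auto.
    - apply locally_intro with (Rmin d (Rmin (a - y) (y - z))).
      { repeat apply Rmin_pos; lra. }
      intros u Hu.
      assert (Rmin d (Rmin (a - y) (y - z)) <= d) by apply Rmin_l.
      assert (Rmin d (Rmin (a - y) (y - z)) <= Rmin (a - y) (y - z)) by apply Rmin_r.
      assert (Rmin (a - y) (y - z) <= a - y) by apply Rmin_l.
      assert (Rmin (a - y) (y - z) <= y - z) by apply Rmin_r.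
      assert (Hu' : two_point s c x u z <= m * Phi x u z).
      { apply Hmax; [unfold prism; repeat split; lra| |apply Rabs_def1; lra|];
          now rewrite Rminus_diag. }
      unfold two_point in Hu', Heq. lra. }
  assert (D3 : s x y * (kappa * c z) + - c y * sz22 + - m * p33 <= 0).
  { apply (second_order_at_local_max (fun u => s x y * c u + - c y * s x u + - m * Phi x y u) z
      (s x y * c1 z + - c y * sz2 + - m * p3)).
    - apply second_order_plus; [apply second_order_plus|]; apply second_order_scal; auto.
    - apply locally_intro with (Rmin d (Rmin (z + a) (y - z))).
      { repeat apply Rmin_pos; lra. }
      intros u Hu.
      assert (Rmin d (Rmin (z + a) (y - z)) <= d) by apply Rmin_l.
      assert (Rmin d (Rmin (z + a) (y - z)) <= Rmin (z + a) (y - z)) by apply Rmin_r.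
      assert (Rmin (z + a) (y - z) <= z + a) by apply Rmin_l.
      assert (Rmin (z + a) (y - z) <= y - z) by apply Rmin_r.
      assert (Hu' : two_point s c x y u <= m * Phi x y u).
      { apply Hmax; [unfold prism; repeat split; lra| | |apply Rabs_def1; lra];
          now rewrite Rminus_diag. }
      unfold two_point in Hu', Heq. lra. }
  assert (Hp := Rmult_lt_compat_l _ _ _ Hm Hlap).
  assert (Hy22 : sy22 = - sy11) by lra. assert (Hz22 : sz22 = - sz11) by lra.
  rewrite Hy22 in D2. rewrite Hz22 in D3.
  unfold two_point in Heq.
  assert (kappa * (s x y * c z - s x z * c y) = m * (kappa * Phi x y z)) by (rewrite Heq; ring).
  lra.
Qed.

(** * Continuity on the prism and the maximum of the quotient *)

Lemma continuous_Rplus {U : UniformSpace} (f g : U -> R) (p : U) :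
  continuous f p -> continuous g p -> continuous (fun q => f q + g q) p.
Proof. exact (continuous_plus (V := R_NormedModule) f g p). Qed.

Lemma continuous_Rminus {U : UniformSpace} (f g : U -> R) (p : U) :
  continuous f p -> continuous g p -> continuous (fun q => f q - g q) p.
Proof. exact (continuous_minus (V := R_NormedModule) f g p). Qed.

Lemma continuous_Rmult {U : UniformSpace} (f g : U -> R) (p : U) :
  continuous f p -> continuous g p -> continuous (fun q => f q * g q) p.
Proof. exact (continuous_mult (K := R_AbsRing) f g p). Qed.

Lemma continuous_of_ex_derive {U : UniformSpace} (f : U -> R) (g : R -> R) (p : U) :
  continuous f p -> ex_derive g (f p) -> continuous (fun q => g (f q)) p.
Proof.
  intros Hf Hg. apply (continuous_comp f g); [exact Hf|].
  now apply (ex_derive_continuous g).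
Qed.

Lemma continuous_Ropp {U : UniformSpace} (f : U -> R) (p : U) :
  continuous f p -> continuous (fun q => - f q) p.
Proof. exact (continuous_opp (V := R_NormedModule) f p). Qed.

Definition px (p : R * R * R) : R := fst (fst p).
Definition py (p : R * R * R) : R := snd (fst p).
Definition pz (p : R * R * R) : R := snd p.

Lemma continuous_px (p : R * R * R) : continuous px p.
Proof.
  apply (continuous_comp (fun q : R * R * R => fst q) (fun q : R * R => fst q)); apply continuous_fst.
Qed.

Lemma continuous_py (p : R * R * R) : continuous py p.
Proof.
  apply (continuous_comp (fun q : R * R * R => fst q) (fun q : R * R => snd q)).
  - apply continuous_fst.
  - apply continuous_snd.
Qed.

Lemma continuous_pz (p : R * R * R) : continuous pz p.
Proof. apply continuous_snd. Qed.

Lemma continuous_corner_dist2 (a : R) (f g : R * R * R -> R) (p : R * R * R) :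
  continuous f p -> continuous g p -> continuous (fun q => corner_dist2 a (f q) (g q)) p.
Proof.
  intros Hf Hg. unfold corner_dist2. apply continuous_Rplus.
  - apply (continuous_of_ex_derive f (fun t => ((1 - t ^ 2) / 2) ^ 2)); [exact Hf|].
    auto_derive; easy.
  - apply (continuous_of_ex_derive g (fun t => (a - t) ^ 2)); [exact Hg|].
    auto_derive; easy.
Qed.

Lemma closed_Rle (f g : R * R * R -> R) :
  (forall p, continuous f p) -> (forall p, continuous g p) -> closed (fun p => f p <= g p).
Proof.
  intros Hf Hg.
  apply (closed_ext (fun p => 0 <= g p - f p)).
  { intros p. lra. }
  apply (closed_comp (fun p => g p - f p) (fun u => 0 <= u)); [|apply closed_ge].
  intros p. now apply continuous_Rminus.
Qed.

Lemma closed_prism (a : R) : closed (fun p => prism a (px p) (py p) (pz p)).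
Proof.
  unfold prism.
  repeat apply closed_and; apply closed_Rle; intros p;
    try apply continuous_const; auto using continuous_px, continuous_py, continuous_pz.
Qed.

Lemma prism_box (a : R) (p : R * R * R) :
  a <= 1 -> prism a (px p) (py p) (pz p) ->
  Rabs (fst (fst p)) <= 1 /\ Rabs (snd (fst p)) <= 1 /\ Rabs (snd p) <= 1.
Proof.
  destruct p as [[x y] z]. unfold prism, px, py, pz; simpl. intros Ha H.
  repeat split; apply Rabs_le; lra.
Qed.

(** Since [s] is continuous only relative to the closed rectangle, both evaluation points are
    followed as maps from the prism into that rectangle. *)
Lemma continuous_on_two_point (a : R) (s : R -> R -> R) (c : R -> R) :
  continuous_on (closed_rect a) (fun p : R * R => s (fst p) (snd p)) ->
  (forall u, continuous c u) ->
  continuous_on (fun p => prism a (px p) (py p) (pz p))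
    (fun p : R * R * R => two_point s c (px p) (py p) (pz p)).
Proof.
  intros Hs Hc [[x y] z] Hp.
  set (F := within (fun p => prism a (px p) (py p) (pz p)) (locally (x, y, z))).
  assert (Hcoord : forall f : R * R * R -> R, continuous f (x, y, z) ->
    filterlim f F (locally (f (x, y, z)))).
  { intros f Hf. eapply filterlim_filter_le_1; [|exact Hf]. apply filter_le_within. }
  assert (Hsf : forall g : R * R * R -> R, continuous g (x, y, z) ->
    (forall p, prism a (px p) (py p) (pz p) -> -a <= g p <= a) ->
    filterlim (fun p => s (px p) (g p)) F (locally (s x (g (x, y, z))))).
  { intros g Hg Hga.
    assert (Hcl : closed_rect a (x, g (x, y, z))).
    { split; [apply Hp|now apply Hga]. }
    apply (filterlim_comp _ _ _ (fun p => (px p, g p)) (fun p : R * R => s (fst p) (snd p)) F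
      (within (closed_rect a) (locally (x, g (x, y, z)))) (locally (s x (g (x, y, z))))).
    - intros P HP. unfold filtermap.
      assert (Hpair : filterlim (fun p => (px p, g p)) (locally (x, y, z)) (locally (x, g (x, y, z)))).
      { apply (continuous_comp_2 px g (fun u v => (u, v))); [apply continuous_px|exact Hg|].
        apply (continuous_ext (fun q : R * R => q)); [now intros [u v]|apply continuous_id]. }
      unfold within in HP. generalize (Hpair _ HP). unfold F, within, filtermap.
      apply filter_imp. intros p H1 H2. apply H1. split; [apply H2|now apply Hga].
    - exact (Hs _ Hcl). }
  assert (HF : Filter F) by (apply within_filter, locally_filter).
  unfold two_point.
  apply (filterlim_comp_2 (G := locally (s x y * c z)) (H := locally (- (s x z * c y)))
     (fun p => s (px p) (py p) * c (pz p)) (fun p => - (s (px p) (pz p) * c (py p))) Rplus).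
  - apply (filterlim_comp_2 (G := locally (s x y)) (H := locally (c z)) _ _ Rmult).
    + apply (Hsf py); [apply continuous_py|]. unfold prism; intros; lra.
    + apply (Hcoord (fun p => c (pz p))). apply (continuous_comp pz c); [apply continuous_pz|apply Hc].
    + exact (filterlim_mult (K := R_AbsRing) (s x y) (c z)).
  - apply (filterlim_comp _ _ _ (fun p => s (px p) (pz p) * c (py p)) Ropp F (locally (s x z * c y))).
    + apply (filterlim_comp_2 (G := locally (s x z)) (H := locally (c y)) _ _ Rmult).
      * apply (Hsf pz); [apply continuous_pz|]. unfold prism; intros; lra.
      * apply (Hcoord (fun p => c (py p))). apply (continuous_comp py c); [apply continuous_py|apply Hc].
      * exact (filterlim_mult (K := R_AbsRing) (s x z) (c y)).
    + exact (filterlim_opp (V := R_NormedModule) (s x z * c y)).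
  - exact (filterlim_plus (V := R_NormedModule) (s x y * c z) (- (s x z * c y))).
Qed.

Lemma continuous_on_continuous {U V : UniformSpace} (D : U -> Prop) (f : U -> V) :
  (forall p, D p -> continuous f p) -> continuous_on D f.
Proof.
  intros H p Hp. eapply filterlim_filter_le_1; [apply filter_le_within|]. now apply H.
Qed.

(** If [two_point s c] were positive somewhere, its quotient by [Phi] would take a value [m0 > 0].
    The numerator is bounded on the whole prism and [Phi] blows up at the removed edges, so the
    quotient is below [m0] near them. Its maximum is therefore attained away from the edges, at a
    contact point excluded by [no_contact]. *)
Lemma two_point_le_0 (a tau kappa : R) (s : R -> R -> R) (c c1 : R -> R)
  (Phi : R -> R -> R -> R) :
  0 < a <= 1 ->
  steklov_solution a tau s ->
  (forall u, is_derive c u (c1 u)) -> (forall u, is_derive c1 u (kappa * c u)) ->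
  c1 a = tau * c a -> c1 (- a) = - tau * c (- a) ->
  (forall x y z, prism a x y z -> off_corners a x y z ->
    0 < Phi x y z /\ strict_supersolution a tau kappa Phi x y z /\
    continuous (fun p => Phi (px p) (py p) (pz p)) (x, y, z)) ->
  (forall N, exists r, 0 < r /\ forall x y z, prism a x y z -> off_corners a x y z ->
    corner_dist2 a x y <= r \/ corner_dist2 a x (- z) <= r -> N < Phi x y z) ->
  forall x y z, prism a x y z -> off_corners a x y z -> two_point s c x y z <= 0.
Proof.
  intros Ha Hs Hc Hc1 Hca Hcma HPhi Hblow x0 y0 z0 Hp0 Hoff0.
  apply Rnot_lt_le. intros HW0.
  assert (Hcc : forall u, continuous c u).
  { intros u. apply (ex_derive_continuous c). eexists; apply Hc. }
  assert (HWc := continuous_on_two_point a s c (solution_continuous _ _ _ Hs) Hcc).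
  set (W := fun p : R * R * R => two_point s c (px p) (py p) (pz p)) in *.
  set (F := fun p : R * R * R => Phi (px p) (py p) (pz p)).
  destruct (max_on_compact_box _ W 1 (fun p => prism_box a p (proj2 Ha)) (closed_prism a) HWc)
    as [pW [HpW HmaxW]]; [now exists (x0, y0, z0)|].
  assert (HWmax := HmaxW (x0, y0, z0) Hp0). unfold W at 1 in HWmax. simpl in HWmax.
  unfold px, py, pz in HWmax; simpl in HWmax.
  assert (HPhi0 : 0 < Phi x0 y0 z0) by now apply HPhi.
  set (m0 := two_point s c x0 y0 z0 / Phi x0 y0 z0).
  assert (Hm0 : 0 < m0) by now apply Rdiv_lt_0_compat.
  destruct (Hblow (W pW / m0)) as [r [Hr Hbig]].
  (* The bound by [r] places the cut inside the zone where the quotient is small; the other two keep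
     [(x0, y0, z0)] in the compact set. *)
  set (r0 := Rmin r (Rmin (corner_dist2 a x0 y0) (corner_dist2 a x0 (- z0)))).
  destruct Hoff0 as [HQ0 HQ0'].
  assert (Hr0 : 0 < r0) by (unfold r0; repeat apply Rmin_pos; lra).
  assert (Hr0r : r0 <= r) by apply Rmin_l.
  assert (Hr0Q : r0 <= Rmin (corner_dist2 a x0 y0) (corner_dist2 a x0 (- z0))) by apply Rmin_r.
  assert (Hm1 := Rmin_l (corner_dist2 a x0 y0) (corner_dist2 a x0 (- z0))).
  assert (Hm2 := Rmin_r (corner_dist2 a x0 y0) (corner_dist2 a x0 (- z0))).
  assert (HcQ : forall p, continuous (fun p => corner_dist2 a (px p) (py p)) p).
  { intros p. apply continuous_corner_dist2; [apply continuous_px|apply continuous_py]. }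
  assert (HcQ' : forall p, continuous (fun p => corner_dist2 a (px p) (- pz p)) p).
  { intros p. apply continuous_corner_dist2; [apply continuous_px|].
    apply continuous_Ropp, continuous_pz. }
  set (K := fun p => prism a (px p) (py p) (pz p) /\
    r0 <= corner_dist2 a (px p) (py p) /\ r0 <= corner_dist2 a (px p) (- pz p)).
  destruct (max_on_compact_box K (fun p => W p / F p) 1) as [[[x y] z] [[Hp [HQ HQ']] Hmax]].
  - intros p Hp. apply (prism_box a); [lra|apply Hp].
  - apply closed_and; [apply closed_prism|].
    apply closed_and; apply closed_Rle; auto; intros p; apply continuous_const.
  - intros p Hp. unfold K in *.
    assert (Hpos : 0 < F p) by (apply HPhi; [|split]; (apply Hp || (destruct Hp; lra))).
    assert (HF : Filter (within K (locally p))) by (apply within_filter, locally_filter).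
    apply (filterlim_comp_2 (G := locally (W p)) (H := locally (/ F p)) W (fun q => / F q) Rmult).
    + eapply filterlim_filter_le_1; [|apply HWc, Hp].
      intros P. unfold within. apply filter_imp. intros q H1 H2. apply H1, H2.
    + eapply filterlim_filter_le_1; [apply filter_le_within|].
      apply (continuous_of_ex_derive F Rinv); [|auto_derive; lra].
      destruct p as [[x y] z]. unfold px, py, pz in Hp; simpl in Hp.
      apply HPhi; [|split]; (apply Hp || (destruct Hp; lra)).
    + exact (filterlim_mult (K := R_AbsRing) (W p) (/ F p)).
  - exists (x0, y0, z0). split; [exact Hp0|]. unfold px, py, pz; simpl. lra.
  - unfold px, py, pz in Hp, HQ, HQ'; simpl in Hp, HQ, HQ'.
    assert (Hoff : off_corners a x y z) by (split; lra).
    destruct (HPhi x y z Hp Hoff) as [Hpos [Hsup _]].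
    set (m := two_point s c x y z / Phi x y z).
    assert (Hm : m0 <= m).
    { apply (Hmax (x0, y0, z0)). split; [exact Hp0|]. unfold px, py, pz; simpl. lra. }
    assert (HWm : two_point s c x y z = m * Phi x y z) by (unfold m; field; lra).
    assert (HWle : two_point s c x y z <= W pW) by exact (HmaxW (x, y, z) Hp).
    (* As [r0 <= r], the maximiser is not on the cut, so maximality over [K] is local maximality
       over the prism. *)
    assert (Hfar : r < corner_dist2 a x y /\ r < corner_dist2 a x (- z)).
    { assert (Hn : ~ (corner_dist2 a x y <= r \/ corner_dist2 a x (- z) <= r)).
      { intros Hor. specialize (Hbig _ _ _ Hp Hoff Hor).
        apply (Rmult_lt_compat_l m0) in Hbig; [|easy].
        replace (m0 * (W pW / m0)) with (W pW) in Hbig by (field; lra).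
        assert (m0 * Phi x y z <= m * Phi x y z) by (apply Rmult_le_compat_r; lra).
        lra. }
      split; apply Rnot_le_lt; intros H; apply Hn; auto. }
    assert (Hzy : z < y).
    { destruct Hp as [_ [[_ Hle] _]]. destruct Hle as [Hlt|E]; [easy|exfalso].
      subst z. unfold two_point in HWm. rewrite Rminus_diag in HWm.
      assert (0 < m * Phi x y y) by (apply Rmult_lt_0_compat; lra). lra. }
    assert (Hloc : locally (x, y, z) (fun p => r0 < corner_dist2 a (px p) (py p) /\
        r0 < corner_dist2 a (px p) (- pz p))).
    { apply filter_and.
      - apply (HcQ (x, y, z) (fun v => r0 < v)). apply open_gt. unfold px, py; simpl; lra.
      - apply (HcQ' (x, y, z) (fun v => r0 < v)). apply open_gt. unfold px, pz; simpl; lra. }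
    destruct Hloc as [d Hd].
    apply (no_contact a tau kappa s c c1 Phi m d x y z); auto; [lra|apply cond_pos|].
    intros x' y' z' Hp' Hx' Hy' Hz'.
    assert (HQQ := Hd (x', y', z') (conj (conj Hx' Hy') Hz')).
    unfold px, py, pz in HQQ; simpl in HQQ.
    assert (Hpos' : 0 < Phi x' y' z') by (apply HPhi; [easy|split; lra]).
    assert (Hle : two_point s c x' y' z' / Phi x' y' z' <= m).
    { apply (Hmax (x', y', z')). split; [exact Hp'|]. unfold px, py, pz; simpl. lra. }
    apply (Rmult_le_compat_r (Phi x' y' z')) in Hle; [|lra].
    replace (two_point s c x' y' z' / Phi x' y' z' * Phi x' y' z')
      with (two_point s c x' y' z') in Hle by (field; lra).
    exact Hle.
Qed.

(** * The comparison function and the choice of its parameters *)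

Lemma is_derive_cosh (x : R) : is_derive cosh x (sinh x).
Proof. apply is_derive_Reals, derivable_pt_lim_cosh. Qed.

Lemma is_derive_sinh (x : R) : is_derive sinh x (cosh x).
Proof. apply is_derive_Reals, derivable_pt_lim_sinh. Qed.

Lemma is_derive_comp_scal (f : R -> R) (k t l : R) :
  is_derive f (k * t) l -> is_derive (fun u => f (k * u)) t (k * l).
Proof.
  intros Hf. evar_last.
  - apply (is_derive_comp f (fun u => k * u)); [exact Hf|]. auto_derive; [easy|reflexivity].
  - simpl. unfold scal; simpl; unfold mult; simpl. ring.
Qed.

Lemma second_order_cosh (nu t : R) :
  second_order_at (fun u => cosh (nu * u)) t (nu * sinh (nu * t)) (nu ^ 2 * cosh (nu * t)).
Proof.
  apply (second_order_intro _ (fun u => nu * sinh (nu * u))).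
  - apply filter_forall. intros u. apply is_derive_comp_scal, is_derive_cosh.
  - replace (nu ^ 2 * cosh (nu * t)) with (nu * (nu * cosh (nu * t))) by ring.
    apply (is_derive_scal (fun u => sinh (nu * u))).
    apply is_derive_comp_scal, is_derive_sinh.
Qed.

Lemma second_order_sin (p q t : R) :
  second_order_at (fun u => sin (p * u + q)) t (p * cos (p * t + q)) (- p ^ 2 * sin (p * t + q)).
Proof.
  apply (second_order_intro _ (fun u => p * cos (p * u + q))).
  - apply filter_forall. intros u. auto_derive; [easy|]. ring.
  - auto_derive; [easy|]. ring.
Qed.

Lemma second_order_of_ode (c c1 : R -> R) (kappa t : R) :
  (forall u, is_derive c u (c1 u)) -> (forall u, is_derive c1 u (kappa * c u)) ->
  second_order_at c t (c1 t) (kappa * c t).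
Proof. intros H H1. apply second_order_intro; [now apply filter_forall|apply H1]. Qed.

Lemma sin_ge_sin_endpoint (g u : R) :
  0 < g -> g <= u <= PI - g -> sin g <= sin u.
Proof.
  intros Hg Hu. destruct (Rle_dec u (PI / 2)) as [H|H].
  - apply sin_incr_1; lra.
  - rewrite <- (sin_PI_x u). apply sin_incr_1; lra.
Qed.

Lemma cosh_ge_1 (x : R) : 1 <= cosh x.
Proof.
  unfold cosh. assert (H := exp_ineq1_le x). assert (H' := exp_ineq1_le (- x)). lra.
Qed.

Lemma cosh_opp (x : R) : cosh (- x) = cosh x.
Proof. unfold cosh. rewrite Ropp_involutive. field. Qed.

Lemma sinh_opp (x : R) : sinh (- x) = - sinh x.
Proof. unfold sinh. rewrite Ropp_involutive. field. Qed.

(* [c] is the y-factor of the separated solutions with Robin parameter [tau] on the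
   horizontal sides. *)
Record profile_data (a tau nu kappa : R) (c c1 : R -> R) : Prop := {
  profile_side : tau * cosh nu < nu * sinh nu;
  profile_top : tau * sin (nu * a) < nu * cos (nu * a);
  profile_gap : 2 * a ^ 2 * (nu ^ 2 - kappa) < PI ^ 2;
  profile_d1 : forall u, is_derive c u (c1 u);
  profile_d2 : forall u, is_derive c1 u (kappa * c u);
  profile_robin : c1 a = tau * c a;
  profile_robin_opp : c1 (- a) = - tau * c (- a);
  profile_bounds : exists c0 C0, 0 < c0 /\ forall u, -a <= u <= a -> c0 <= c u <= C0;
  profile_mono : forall y z, -a <= z <= y -> y <= a ->
    sin (nu * z) * c y <= sin (nu * y) * c z
}.

(* The first two terms form an exact solution, strict on the faces but zero on y = z; the
   concave perturbation makes it positive there and the interior inequality strict. *)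
Definition comparison_angle (nu eta beta gamma : R) (c : R -> R) (y z : R) : R :=
  sin (nu * y) * c z - sin (nu * z) * c y + eta * sin (beta * (y - z) + gamma).

Definition comparison (a nu eta beta gamma eps B : R) (c : R -> R) (x y z : R) : R :=
  cosh (nu * x) * comparison_angle nu eta beta gamma c y z
  + eps * (corner_barrier a B x y * c z + corner_barrier a B x (- z) * c y).

(** Three slacks pay for the perturbations. On [y = a] and [z = - a] the gap in [profile_top]
    dominates the term with [eta]. On [x^2 = 1] the gap in [profile_side] multiplies the whole
    angle, including that term. Inside, the concavity of the sine dominates the Laplacian of the
    poles. The poles do no harm on the faces because [tau <= B]. *)
Lemma comparison_supersolution (a tau nu kappa eta beta gamma eps B M c0 C0 : R)
  (c c1 : R -> R) (x y z : R) :
  profile_data a tau nu kappa c c1 ->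
  0 < a <= 1 -> 0 < c0 -> (forall u, -a <= u <= a -> c0 <= c u <= C0) ->
  0 < beta -> 0 < gamma -> 2 * a * beta + 2 * gamma = PI ->
  0 < eta -> eta * (beta + Rabs tau) < c0 * (nu * cos (nu * a) - tau * sin (nu * a)) ->
  0 < eps -> eps * (2 * C0 * M) < eta * sin gamma * (2 * beta ^ 2 + kappa - nu ^ 2) ->
  0 < 2 * beta ^ 2 + kappa - nu ^ 2 ->
  B = Rabs tau -> 0 <= M ->
  (forall x y, -1 <= x <= 1 -> -a <= y <= a -> 0 < corner_dist2 a x y ->
    corner_barrier_dxx a B x y + corner_barrier_dyy a B x y <= M) ->
  prism a x y z -> off_corners a x y z ->
  0 < comparison_angle nu eta beta gamma c y z /\
  strict_supersolution a tau kappa (comparison a nu eta beta gamma eps B c) x y z.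
Proof.
  intros Hdata Ha Hc0 Hcb Hbeta Hgamma Hbg Heta Heta' Heps Heps' Hgap HB HM HDb
    [Hx [[Hz1 Hz2] Hy]] [HQ HQ'].
  destruct Hdata as [Hside Htop _ Dc Dc1 Hca Hcma _ Hmono].
  assert (Hcy := Hcb y ltac:(lra)). assert (Hcz := Hcb z ltac:(lra)).
  assert (HB0 : 0 <= B) by (rewrite HB; apply Rabs_pos).
  assert (HBt : tau <= B) by (rewrite HB; apply Rle_abs).
  assert (Hb := corner_barrier_nonneg a B x y (proj2 Ha) HB0 Hx ltac:(lra) HQ).
  assert (Hb' := corner_barrier_nonneg a B x (- z) (proj2 Ha) HB0 Hx ltac:(lra) HQ').
  set (arg := beta * (y - z) + gamma).
  (* Since [0 <= y - z <= 2 a], the relation [2 a beta + 2 gamma = PI] confines the phase to an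
     interval symmetric about [PI / 2], where the sine is at least [sin gamma]. *)
  assert (Harg : gamma <= arg <= PI - gamma).
  { unfold arg. assert (0 <= beta * (y - z)) by (apply Rmult_le_pos; lra).
    assert (beta * (y - z) <= beta * (2 * a)) by (apply Rmult_le_compat_l; lra). lra. }
  assert (Hsg : 0 < sin gamma).
  { assert (0 < a * beta) by (apply Rmult_lt_0_compat; lra). apply sin_gt_0; lra. }
  assert (HS := sin_ge_sin_endpoint gamma arg Hgamma Harg).
  assert (Hm := Hmono y z ltac:(lra) Hy).
  assert (Hth : 0 < comparison_angle nu eta beta gamma c y z).
  { unfold comparison_angle. fold arg.
    assert (0 < eta * sin arg) by (apply Rmult_lt_0_compat; lra). lra. }
  assert (Hcosh := cosh_ge_1 (nu * x)).
  assert (Hosc : Rabs (beta * cos arg - tau * sin arg) <= beta + Rabs tau).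
  { unfold Rminus. eapply Rle_trans; [apply Rabs_triang|].
    rewrite Rabs_Ropp, !Rabs_mult, (Rabs_pos_eq beta) by lra.
    assert (H1 := COS_bound arg). assert (H2 := SIN_bound arg).
    assert (Rabs (cos arg) <= 1) by now apply Rabs_le.
    assert (Rabs (sin arg) <= 1) by now apply Rabs_le.
    assert (H5 := Rabs_pos tau). nra. }
  assert (Hosc' : - (c0 * (nu * cos (nu * a) - tau * sin (nu * a)))
                  < eta * (beta * cos arg - tau * sin arg)).
  { apply Rabs_le_between in Hosc.
    assert (eta * - (beta + Rabs tau) <= eta * (beta * cos arg - tau * sin arg))
      by (apply Rmult_le_compat_l; lra). lra. }
  split; [exact Hth|].
  assert (Dc2 := fun t => second_order_of_ode c c1 kappa t Dc Dc1).
  assert (By := corner_barrier_second_order_y a B x (- z) HQ').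
  apply second_order_reflect in By.
  (* The derivatives are found by unification, from each coordinate slice of [comparison] written as
     a linear combination of known functions. *)
  do 6 eexists. split; [|split; [|split; [|split; [|split; [|split]]]]].
  - eapply second_order_ext; [|reflexivity|reflexivity|].
    2: { apply second_order_plus.
         - apply (second_order_scal (comparison_angle nu eta beta gamma c y z)).
           apply (second_order_cosh nu).
         - apply second_order_plus.
           + apply (second_order_scal (eps * c z)).
             apply (corner_barrier_second_order_x a B), HQ.
           + apply (second_order_scal (eps * c y)).
             apply (corner_barrier_second_order_x a B), HQ'. }
    intros u. unfold comparison. ring.
  - eapply second_order_ext; [|reflexivity|reflexivity|].
    2: { apply second_order_plus.
         - apply second_order_plus.
           + apply (second_order_scal (cosh (nu * x) * c z)). apply (second_order_sin nu 0).
           + apply second_order_plus.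
             * apply (second_order_scal (cosh (nu * x) * eta)).
               apply (second_order_sin beta (- beta * z + gamma)).
             * apply (second_order_scal (eps * c z)).
               apply (corner_barrier_second_order_y a B), HQ.
         - apply (second_order_scal
             (eps * corner_barrier a B x (- z) - cosh (nu * x) * sin (nu * z))).
           apply Dc2. }
    intros u. unfold comparison, comparison_angle. simpl.
    rewrite Rplus_0_r. replace (beta * u + (- beta * z + gamma)) with (beta * (u - z) + gamma) by ring.
    ring.
  - eapply second_order_ext; [|reflexivity|reflexivity|].
    2: { apply second_order_plus.
         - apply second_order_plus.
           + apply (second_order_scal (- cosh (nu * x) * c y)). apply (second_order_sin nu 0).
           + apply second_order_plus.
             * apply (second_order_scal (cosh (nu * x) * eta)).
               apply (second_order_sin (- beta) (beta * y + gamma)).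
             * apply (second_order_scal (eps * c y)). exact By.
         - apply (second_order_scal
             (eps * corner_barrier a B x y + cosh (nu * x) * sin (nu * y))).
           apply Dc2. }
    intros u. unfold comparison, comparison_angle. simpl.
    rewrite Rplus_0_r. replace (- beta * u + (beta * y + gamma)) with (beta * (y - u) + gamma) by ring.
    ring.
  - rewrite !Rplus_0_r.
    replace (beta * y + (- beta * z + gamma)) with arg by (unfold arg; ring).
    replace (- beta * z + (beta * y + gamma)) with arg by (unfold arg; ring).
    assert (L1 := HDb x y Hx ltac:(lra) HQ). assert (L2 := HDb x (- z) Hx ltac:(lra) HQ').
    unfold comparison, comparison_angle. fold arg.
    set (b11 := corner_barrier_dxx a B x y) in *. set (b22 := corner_barrier_dyy a B x y) in *.
    set (b11' := corner_barrier_dxx a B x (- z)) in *.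
    set (b22' := corner_barrier_dyy a B x (- z)) in *.
    assert (E1 : c z * (b11 + b22) <= C0 * M) by (apply Rle_trans with (c z * M); nra).
    assert (E2 : c y * (b11' + b22') <= C0 * M) by (apply Rle_trans with (c y * M); nra).
    assert (E3 : eps * (c z * (b11 + b22) + c y * (b11' + b22')) <= eps * (2 * C0 * M))
      by (apply Rmult_le_compat_l; lra).
    assert (E4 : eta * sin gamma * (2 * beta ^ 2 + kappa - nu ^ 2)
                 <= cosh (nu * x) * (eta * sin arg * (2 * beta ^ 2 + kappa - nu ^ 2))).
    { assert (eta * sin gamma <= eta * sin arg) by (apply Rmult_le_compat_l; lra).
      assert (0 <= eta * sin gamma) by (apply Rmult_le_pos; lra).
      apply Rle_trans with (1 * (eta * sin arg * (2 * beta ^ 2 + kappa - nu ^ 2))).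
      - rewrite Rmult_1_l. apply Rmult_le_compat_r; lra.
      - apply Rmult_le_compat_r; [apply Rmult_le_pos; lra|lra]. }
    lra.
  - intros Hx1. rewrite !corner_barrier_dx_side by exact Hx1.
    assert (Hsc : x * (nu * sinh (nu * x)) = nu * sinh nu /\ cosh (nu * x) = cosh nu).
    { assert (Hxn : x = 1 \/ x = -1) by nra. destruct Hxn as [->| ->].
      - rewrite Rmult_1_r. split; [ring|easy].
      - replace (nu * -1) with (- nu) by ring. rewrite sinh_opp, cosh_opp. split; [ring|easy]. }
    destruct Hsc as [Hs Hch].
    unfold comparison. set (th := comparison_angle nu eta beta gamma c y z) in *.
    set (b := corner_barrier a B x y) in *. set (b' := corner_barrier a B x (- z)) in *.
    replace (x * (th * (nu * sinh (nu * x)) +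
      (eps * c z * (x * (B * b)) + eps * c y * (x * (B * b')))))
      with (th * (x * (nu * sinh (nu * x))) + x ^ 2 * (eps * (B * (b * c z + b' * c y)))) by ring.
    rewrite Hs, Hch, Hx1.
    assert (th * (tau * cosh nu) < th * (nu * sinh nu)) by now apply Rmult_lt_compat_l.
    assert (0 <= b * c z) by (apply Rmult_le_pos; lra).
    assert (0 <= b' * c y) by (apply Rmult_le_pos; lra).
    assert (tau * (b * c z + b' * c y) <= B * (b * c z + b' * c y))
      by (apply Rmult_le_compat_r; lra).
    assert (eps * (tau * (b * c z + b' * c y)) <= eps * (B * (b * c z + b' * c y)))
      by (apply Rmult_le_compat_l; lra).
    lra.
  - intros ->. rewrite corner_barrier_dy_top, Hca, !Rplus_0_r.
    replace (beta * a + (- beta * z + gamma)) with arg by (unfold arg; ring).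
    unfold comparison, comparison_angle. fold arg.
    set (b := corner_barrier a B x a) in *. set (b' := corner_barrier a B x (- z)) in *. clearbody b b'.
    assert (0 <= eps * ((B - tau) * (b * c z))).
    { repeat apply Rmult_le_pos; lra. }
    assert (0 < cosh (nu * x) * (c z * (nu * cos (nu * a) - tau * sin (nu * a))
                + eta * (beta * cos arg - tau * sin arg))).
    { apply Rmult_lt_0_compat; [lra|].
      assert (c0 * (nu * cos (nu * a) - tau * sin (nu * a))
              <= c z * (nu * cos (nu * a) - tau * sin (nu * a))) by (apply Rmult_le_compat_r; lra).
      lra. }
    lra.
  - intros ->. rewrite Ropp_involutive, corner_barrier_dy_top, Hcma, !Rplus_0_r.
    replace (- beta * - a + (beta * y + gamma)) with arg by (unfold arg; ring).
    unfold comparison, comparison_angle. fold arg. rewrite Ropp_involutive.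
    rewrite Ropp_involutive in Hb'.
    replace (nu * - a) with (- (nu * a)) by ring. rewrite sin_neg, cos_neg.
    set (b := corner_barrier a B x y) in *. set (b' := corner_barrier a B x a) in *. clearbody b b'.
    assert (0 <= eps * ((B - tau) * (b' * c y))).
    { repeat apply Rmult_le_pos; lra. }
    assert (0 < cosh (nu * x) * (c y * (nu * cos (nu * a) - tau * sin (nu * a))
                + eta * (beta * cos arg - tau * sin arg))).
    { apply Rmult_lt_0_compat; [lra|].
      assert (c0 * (nu * cos (nu * a) - tau * sin (nu * a))
              <= c y * (nu * cos (nu * a) - tau * sin (nu * a))) by (apply Rmult_le_compat_r; lra).
      lra. }
    lra.
Qed.

Lemma continuous_corner_barrier (a B : R) (f g : R * R * R -> R) (p : R * R * R) :
  continuous f p -> continuous g p -> 0 < corner_dist2 a (f p) (g p) ->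
  continuous (fun q => corner_barrier a B (f q) (g q)) p.
Proof.
  intros Hf Hg HQ. unfold corner_barrier. apply continuous_Rmult.
  - apply (continuous_of_ex_derive (fun q => B * f q ^ 2 / 2 + B * g q) exp); [|auto_derive; easy].
    apply continuous_Rplus.
    + apply (continuous_of_ex_derive f (fun t => B * t ^ 2 / 2)); [exact Hf|auto_derive; easy].
    + apply (continuous_of_ex_derive g (fun t => B * t)); [exact Hg|auto_derive; easy].
  - apply (continuous_of_ex_derive (fun q => corner_dist2 a (f q) (g q)) (log_profile (barrier_coef B))).
    + now apply continuous_corner_dist2.
    + eexists. now apply is_derive_log_profile.
Qed.

Lemma continuous_comparison (a nu eta beta gamma eps B : R) (c : R -> R) (x y z : R) :
  (forall u, ex_derive c u) -> off_corners a x y z ->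
  continuous (fun p => comparison a nu eta beta gamma eps B c (px p) (py p) (pz p)) (x, y, z).
Proof.
  intros Hc [HQ HQ'].
  assert (HX := continuous_px (x, y, z)). assert (HY := continuous_py (x, y, z)).
  assert (HZ := continuous_pz (x, y, z)).
  assert (HcY : continuous (fun p => c (py p)) (x, y, z)) by now apply continuous_of_ex_derive.
  assert (HcZ : continuous (fun p => c (pz p)) (x, y, z)) by now apply continuous_of_ex_derive.
  unfold comparison, comparison_angle.
  apply continuous_Rplus; [apply continuous_Rmult|apply continuous_Rmult].
  - apply (continuous_of_ex_derive px (fun t => cosh (nu * t))); [exact HX|].
    eexists. apply is_derive_comp_scal, is_derive_cosh.
  - apply continuous_Rplus; [apply continuous_Rminus; apply continuous_Rmult; auto|].
    + apply (continuous_of_ex_derive py (fun t => sin (nu * t))); [exact HY|auto_derive; easy].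
    + apply (continuous_of_ex_derive pz (fun t => sin (nu * t))); [exact HZ|auto_derive; easy].
    + apply (continuous_of_ex_derive (fun p => py p - pz p) (fun t => eta * sin (beta * t + gamma))).
      * now apply continuous_Rminus.
      * auto_derive; easy.
  - apply continuous_const.
  - apply continuous_Rplus; apply continuous_Rmult; auto; apply continuous_corner_barrier; auto.
    now apply continuous_Ropp.
Qed.

(** In terms of [th = 2 a beta] the demands are [th < PI] and [th^2 > 2 a^2 (nu^2 - kappa)], which
    is the origin of the bound [PI^2] in [profile_gap]. The square [w] of [th] is the midpoint of
    the allowed interval; the maximum with 0 covers [nu^2 < kappa]. *)
Lemma exists_comparison_parameters (a nu kappa : R) :
  0 < a -> 2 * a ^ 2 * (nu ^ 2 - kappa) < PI ^ 2 ->
  exists beta gamma, 0 < beta /\ 0 < gamma /\ 2 * a * beta + 2 * gamma = PI /\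
    0 < 2 * beta ^ 2 + kappa - nu ^ 2.
Proof.
  intros Ha Hgap. assert (HPI := PI_RGT_0).
  set (u := 2 * a ^ 2 * (nu ^ 2 - kappa)) in *.
  set (w := (Rmax 0 u + PI ^ 2) / 2).
  assert (H0 := Rmax_l 0 u). assert (H1 := Rmax_r 0 u).
  assert (H2 : Rmax 0 u < PI ^ 2) by (apply Rmax_lub_lt; [nra|easy]).
  assert (Hw : 0 < w) by (unfold w; nra).
  set (th := sqrt w).
  assert (Hth : 0 < th) by now apply sqrt_lt_R0.
  assert (Hth2 : th * th = w) by (apply sqrt_sqrt; lra).
  assert (HthPI : th < PI) by (unfold w in Hth2; nra).
  exists (th / (2 * a)), ((PI - th) / 2).
  split; [apply Rdiv_lt_0_compat; lra|]. split; [lra|]. split; [field; lra|].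
  replace (2 * (th / (2 * a)) ^ 2 + kappa - nu ^ 2) with ((th * th - u) / (2 * a ^ 2))
    by (unfold u; field; lra).
  apply Rdiv_lt_0_compat; [unfold w in *; lra|nra].
Qed.

(** The order of the choices matters: [beta] and [gamma] from the gap, then [eta] against the slack
    on the horizontal faces, and last [eps] against the interior slack that [eta] creates. *)
Lemma two_point_nonpos (a tau nu kappa : R) (s : R -> R -> R) (c c1 : R -> R) (x y z : R) :
  0 < a <= 1 -> profile_data a tau nu kappa c c1 -> steklov_solution a tau s ->
  prism a x y z -> off_corners a x y z -> two_point s c x y z <= 0.
Proof.
  intros Ha Hdata Hs. revert x y z.
  destruct (profile_bounds _ _ _ _ _ _ Hdata) as [c0 [C0 [Hc0 Hcb]]].
  assert (HC0 : 0 < C0) by (assert (H := Hcb 0 ltac:(lra)); lra).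
  assert (Hg := profile_top _ _ _ _ _ _ Hdata).
  set (g := nu * cos (nu * a) - tau * sin (nu * a)).
  assert (Hg0 : 0 < g) by (unfold g; lra).
  destruct (exists_comparison_parameters a nu kappa (proj1 Ha) (profile_gap _ _ _ _ _ _ Hdata))
    as [beta [gamma [Hbeta [Hgamma [Hbg Hlap]]]]].
  assert (HB : 0 <= Rabs tau) by apply Rabs_pos.
  destruct (corner_barrier_laplacian_le a (Rabs tau) (proj2 Ha) HB) as [M [HM HDb]].
  set (eta := c0 * g / (2 * (beta + Rabs tau))).
  assert (Hc0g : 0 < c0 * g) by now apply Rmult_lt_0_compat.
  assert (Heta : 0 < eta) by (apply Rdiv_lt_0_compat; lra).
  assert (Heta' : eta * (beta + Rabs tau) < c0 * g).
  { replace (eta * (beta + Rabs tau)) with (c0 * g / 2) by (unfold eta; field; lra). lra. }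
  assert (Hsg : 0 < sin gamma).
  { assert (0 < a * beta) by (apply Rmult_lt_0_compat; lra). apply sin_gt_0; lra. }
  set (del := eta * sin gamma * (2 * beta ^ 2 + kappa - nu ^ 2)).
  assert (Hdel : 0 < del) by (apply Rmult_lt_0_compat; [apply Rmult_lt_0_compat|]; easy).
  assert (HCM : 0 <= C0 * M) by (apply Rmult_le_pos; lra).
  (* The added 1 keeps the denominator positive when [M = 0]. *)
  set (eps := del / (2 * C0 * M + 1)).
  assert (Heps : 0 < eps) by (apply Rdiv_lt_0_compat; lra).
  assert (Heps' : eps * (2 * C0 * M) < del).
  { assert (eps * (2 * C0 * M + 1) = del) by (unfold eps; field; lra). lra. }
  assert (Hsup := fun x y z => comparison_supersolution a tau nu kappa eta beta gamma eps
    (Rabs tau) M c0 C0 c c1 x y z Hdata Ha Hc0 Hcb Hbeta Hgamma Hbg Heta Heta' Heps Heps'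
    Hlap eq_refl HM HDb).
  assert (Hlow : forall x y z, prism a x y z -> off_corners a x y z ->
    0 < cosh (nu * x) * comparison_angle nu eta beta gamma c y z /\
    0 <= corner_barrier a (Rabs tau) x y * c z /\
    0 <= corner_barrier a (Rabs tau) x (- z) * c y).
  { intros x y z Hp Hoff. destruct (Hsup x y z Hp Hoff) as [Hth _].
    destruct Hp as [Hx [[Hz1 Hz2] Hy]], Hoff as [HQ HQ'].
    assert (Hcosh := cosh_ge_1 (nu * x)).
    assert (Hcy := Hcb y ltac:(lra)). assert (Hcz := Hcb z ltac:(lra)).
    split; [apply Rmult_lt_0_compat; lra|].
    split; (apply Rmult_le_pos; [apply corner_barrier_nonneg; lra|lra]). }
  apply (two_point_le_0 a tau kappa s c c1 (comparison a nu eta beta gamma eps (Rabs tau) c));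
    try easy; try apply Hdata.
  - intros x y z Hp Hoff. destruct (Hlow x y z Hp Hoff) as [H1 [H2 H3]].
    split; [|split].
    + unfold comparison. apply Rplus_lt_le_0_compat; [easy|]. apply Rmult_le_pos; lra.
    + now apply Hsup.
    + apply continuous_comparison; [|easy]. intros u. eexists. apply Hdata.
  - intros N.
    set (A := eps * (exp (- Rabs tau) * c0)).
    assert (HA : 0 < A) by (apply Rmult_lt_0_compat; [easy|apply Rmult_lt_0_compat; [apply exp_pos|easy]]).
    set (T := Rabs N / A).
    assert (HT : 0 <= T) by (apply Rdiv_le_0_compat; [apply Rabs_pos|easy]).
    assert (HNT : N <= T * A).
    { replace (T * A) with (Rabs N) by (unfold T; field; lra). apply Rle_abs. }
    (* Below this value [- ln (corner_dist2) / 2] is at least [T], so one pole alone contributes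
       [T * A >= N]; the positive first term of [comparison] makes the inequality strict. *)
    exists (exp (- 2 * T)). split; [apply exp_pos|].
    assert (Hexp1 : exp (- 2 * T) <= 1).
    { rewrite <- exp_0. destruct HT as [HT| <-]; [left; apply exp_increasing; lra|].
      right; f_equal; ring. }
    assert (Hbig : forall x y, -1 <= x <= 1 -> -a <= y <= a -> 0 < corner_dist2 a x y ->
      corner_dist2 a x y <= exp (- 2 * T) -> exp (- Rabs tau) * T <= corner_barrier a (Rabs tau) x y).
    { intros x y Hx Hy HQ HQr.
      eapply Rle_trans; [|apply corner_barrier_ge_ln; lra].
      apply Rmult_le_compat_l; [apply Rlt_le, exp_pos|].
      apply ln_le in HQr; [|easy]. rewrite ln_exp in HQr. lra. }
    intros x y z Hp Hoff HQr.
    destruct (Hlow x y z Hp Hoff) as [H1 [H2 H3]].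
    destruct Hp as [Hx [[Hz1 Hz2] Hy]], Hoff as [HQ HQ'].
    assert (Hcy := Hcb y ltac:(lra)). assert (Hcz := Hcb z ltac:(lra)).
    assert (HeT : 0 <= exp (- Rabs tau) * T) by (apply Rmult_le_pos; [apply Rlt_le, exp_pos|easy]).
    unfold comparison.
    assert (Hlo : T * A <= eps * (corner_barrier a (Rabs tau) x y * c z
                                 + corner_barrier a (Rabs tau) x (- z) * c y)).
    { replace (T * A) with (eps * ((exp (- Rabs tau) * T) * c0)) by (unfold A; ring).
      apply Rmult_le_compat_l; [lra|].
      destruct HQr as [HQr|HQr].
      - assert (H4 := Hbig x y Hx ltac:(lra) HQ HQr).
        assert ((exp (- Rabs tau) * T) * c0 <= corner_barrier a (Rabs tau) x y * c z)
          by (apply Rmult_le_compat; lra). lra.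
      - assert (H4 := Hbig x (- z) Hx ltac:(lra) HQ' HQr).
        assert ((exp (- Rabs tau) * T) * c0 <= corner_barrier a (Rabs tau) x (- z) * c y)
          by (apply Rmult_le_compat; lra). lra. }
    lra.
Qed.

Lemma steklov_solution_opp (a tau : R) (s : R -> R -> R) :
  steklov_solution a tau s -> steklov_solution a tau (fun x y => - s x y).
Proof.
  intros Hs. constructor.
  - intros p Hp.
    apply (filterlim_comp _ _ _ (fun q => s (fst q) (snd q)) Ropp _ (locally (s (fst p) (snd p)))).
    + exact (solution_continuous _ _ _ Hs p Hp).
    + exact (filterlim_opp (V := R_NormedModule) (s (fst p) (snd p))).
  - intros x y Hxy.
    destruct (solution_harmonic _ _ _ Hs x y Hxy) as [p [pxx [q [qyy [H1 [H2 H3]]]]]].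
    exists (-1 * p), (-1 * pxx), (-1 * q), (-1 * qyy). split; [|split; [|lra]].
    + apply (second_order_ext (fun u => -1 * s u y) _ _ (-1 * p) (-1 * pxx)); auto.
      * intros u; ring.
      * now apply second_order_scal.
    + apply (second_order_ext (fun u => -1 * s x u) _ _ (-1 * q) (-1 * qyy)); auto.
      * intros u; ring.
      * now apply second_order_scal.
  - intros x y nx ny Hn.
    assert (H := solution_boundary _ _ _ Hs x y nx ny Hn). unfold is_normal_derivative in *.
    replace (tau * - s x y) with (-1 * (tau * s x y) + 0 * (tau * s x y)) by ring.
    eapply filterlim_ext; [|exact (filterlim_lincomb _ _ (-1) 0 _ _ H H)].
    intros h. simpl. unfold Rdiv. ring.
Qed.

Lemma corner_dist2_pos (a x y : R) : -1 < x < 1 -> 0 < corner_dist2 a x y.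
Proof.
  intros Hx. unfold corner_dist2.
  assert (0 < ((1 - x ^ 2) / 2) ^ 2) by (apply pow_lt; nra).
  assert (H1 := pow2_ge_0 (a - y)). lra.
Qed.

(** The bounds for [s] and [- s] squeeze [two_point] to 0 for [z <= y]; antisymmetry covers the
    other order. *)
Lemma steklov_solution_separates (a tau nu kappa : R) (s : R -> R -> R) (c c1 : R -> R) (x y z : R) :
  0 < a <= 1 -> profile_data a tau nu kappa c c1 -> steklov_solution a tau s ->
  -1 < x < 1 -> -a < y < a -> -a < z < a -> s x y * c z = s x z * c y.
Proof.
  intros Ha Hdata Hs Hx.
  assert (Hord : forall y z, -a < y < a -> -a < z < a -> z <= y -> s x y * c z = s x z * c y).
  { clear y z. intros y z Hy Hz Hzy.
    assert (Hp : prism a x y z) by (unfold prism; lra).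
    assert (Hoff : off_corners a x y z) by (split; now apply corner_dist2_pos).
    assert (H1 := two_point_nonpos a tau nu kappa s c c1 x y z Ha Hdata Hs Hp Hoff).
    assert (H2 := two_point_nonpos a tau nu kappa _ c c1 x y z Ha Hdata
      (steklov_solution_opp a tau s Hs) Hp Hoff).
    unfold two_point in H1, H2. lra. }
  intros Hy Hz. destruct (Rle_dec z y) as [H|H]; [now apply Hord|].
  symmetry. apply Hord; lra.
Qed.

(** * Separation of variables *)

(** As [second_order_at] is a relation, this is what allows the second derivative of a slice of [s]
    to be computed from the separated formula. *)
Lemma second_order_unique_loc (f g : R -> R) (t f1 f2 g1 g2 : R) :
  locally t (fun u => f u = g u) ->
  second_order_at f t f1 f2 -> second_order_at g t g1 g2 -> f2 = g2.
Proof.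
  intros Heq [f' [Hf [_ Hf2]]] [g' [Hg [_ Hg2]]].
  assert (H : locally t (fun u => f' u = g' u)).
  { generalize (filter_and _ _ (locally_locally _ _ Heq) (filter_and _ _ Hf Hg)).
    apply filter_imp. intros u [H1 [H2 H3]].
    rewrite <- (is_derive_unique _ _ _ H2), <- (is_derive_unique _ _ _ H3).
    now apply Derive_ext_loc. }
  assert (Hf2' : is_derive g' t f2) by now apply (is_derive_ext_loc f' g').
  rewrite <- (is_derive_unique _ _ _ Hf2'). now apply is_derive_unique.
Qed.

Lemma steklov_eigenfunction_solution (a tau : R) (s : R -> R -> R) :
  steklov_eigenfunction a tau s -> steklov_solution a tau s.
Proof.
  intros [Hcont _ _ Hharm Hbdry]. constructor; [exact Hcont| |exact Hbdry].
  intros x y Hxy. destruct (Hharm x y Hxy) as [Hd Heq].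
  destruct Hxy as [Hx Hy]; simpl in Hx, Hy.
  exists (Derive (fun u => s u y) x), (partial_derive 2 0 s x y),
    (Derive (fun u => s x u) y), (partial_derive 0 2 s x y).
  destruct Hd as [_ [_ [_ [[_ [Hdx _]] [_ [_ [Hdy _]]]]]]].
  split; [|split; [|exact Heq]].
  - apply second_order_intro.
    + apply locally_intro with (Rmin (1 - x) (1 + x)); [apply Rmin_pos; lra|].
      intros u Hu. assert (H1 := Rmin_l (1 - x) (1 + x)). assert (H2 := Rmin_r (1 - x) (1 + x)).
      apply Derive_correct. apply (Hharm u y). split; simpl; lra.
    + exact (Derive_correct _ _ Hdx).
  - apply (second_order_intro (fun u => s x u) (fun v => Derive (fun u => s x u) v)).
    + apply locally_intro with (Rmin (a - y) (a + y)); [apply Rmin_pos; lra|].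
      intros u Hu. assert (H1 := Rmin_l (a - y) (a + y)). assert (H2 := Rmin_r (a - y) (a + y)).
      apply Derive_correct. apply (Hharm x u). split; simpl; lra.
    + exact (Derive_correct _ _ Hdy).
Qed.

Lemma constant_of_zero_derivative (W : R -> R) :
  (forall u, -1 < u < 1 -> is_derive W u 0) -> forall x, -1 < x < 1 -> W x = W 0.
Proof.
  intros H x Hx. destruct (Rtotal_order x 0) as [Hlt|[->|Hgt]]; [|easy|].
  - apply (eq_is_derive W x 0); [|lra]. intros t Ht. apply H. lra.
  - symmetry. apply (eq_is_derive W 0 x); [|lra]. intros t Ht. apply H. lra.
Qed.

(** [W1] and [W2] are Wronskians of [f] with the odd and the even fundamental solution, hence
    constant. The identity [e^2 + kappa o^2 = 1] inverts the system to [f = W1 e + W2 o]. *)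
Lemma ode_solution (f f1 e o : R -> R) (kappa : R) :
  (forall u, -1 < u < 1 -> is_derive f u (f1 u) /\ is_derive f1 u (- kappa * f u)) ->
  (forall u, is_derive e u (- kappa * o u)) -> (forall u, is_derive o u (e u)) ->
  (forall u, e u ^ 2 + kappa * o u ^ 2 = 1) ->
  exists A B, forall x, -1 < x < 1 -> f x = A * e x + B * o x.
Proof.
  intros Hf He Ho Heo.
  set (W1 := fun u => f u * e u - f1 u * o u).
  set (W2 := fun u => kappa * f u * o u + f1 u * e u).
  exists (W1 0), (W2 0). intros x Hx.
  assert (H1 : W1 x = W1 0).
  { apply constant_of_zero_derivative; [|exact Hx]. intros u Hu. destruct (Hf u Hu) as [D1 D2].
    unfold W1. evar_last.
    - auto_derive; [|reflexivity].
      assert (ex_derive f u) by (eexists; apply D1). assert (ex_derive f1 u) by (eexists; apply D2).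
      assert (ex_derive e u) by (eexists; apply He). assert (ex_derive o u) by (eexists; apply Ho).
      tauto.
    - rewrite (Derive_eta _ _ _ D1), (Derive_eta _ _ _ D2), (Derive_eta _ _ _ (He u)),
        (Derive_eta _ _ _ (Ho u)). ring. }
  assert (H2 : W2 x = W2 0).
  { apply constant_of_zero_derivative; [|exact Hx]. intros u Hu. destruct (Hf u Hu) as [D1 D2].
    unfold W2. evar_last.
    - auto_derive; [|reflexivity].
      assert (ex_derive f u) by (eexists; apply D1). assert (ex_derive f1 u) by (eexists; apply D2).
      assert (ex_derive e u) by (eexists; apply He). assert (ex_derive o u) by (eexists; apply Ho).
      tauto.
    - rewrite (Derive_eta _ _ _ D1), (Derive_eta _ _ _ D2), (Derive_eta _ _ _ (He u)),
        (Derive_eta _ _ _ (Ho u)). ring. }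
  rewrite <- H1, <- H2. unfold W1, W2.
  replace ((f x * e x - f1 x * o x) * e x + (kappa * f x * o x + f1 x * e x) * o x)
    with (f x * (e x ^ 2 + kappa * o x ^ 2)) by ring.
  rewrite Heo. ring.
Qed.

(* [L] is only known to agree with [f] on the inner side of [n], so the finiteness of the limit
   [l] also forces the endpoint values to agree. *)
Lemma one_sided_derivative_of_extension (f : R -> R) (L : R -> R) (n v l l' : R) :
  filterlim (fun h => (v - f (n - h * n)) / h) (at_right 0) (locally l) ->
  (forall h, 0 < h < 1 -> f (n - h * n) = L (n - h * n)) ->
  is_derive L n l' -> v = L n /\ l = n * l'.
Proof.
  intros Hl Hf HL.
  assert (HqL := left_quotient_is_derive L n n l' HL).
  assert (Hev : at_right 0 (fun h => 0 < h < 1)).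
  { apply at_right_0_intro with 1; [lra|]. now intros h Hh. }
  assert (Hd : filterlim (fun h => (v - L n) / h) (at_right 0) (locally (1 * l + -1 * (n * l')))).
  { eapply filterlim_ext_loc; [|exact (filterlim_lincomb _ _ 1 (-1) _ _ Hl HqL)].
    revert Hev. apply filter_imp. intros h Hh. simpl. rewrite (Hf h Hh). field. lra. }
  assert (Hid : filterlim (fun h : R => h) (at_right 0) (locally 0)).
  { eapply filterlim_filter_le_1; [apply filter_le_within|]. apply filterlim_id. }
  assert (Hv : v - L n = 0).
  { apply (filterlim_locally_unique (F := at_right 0) (fun _ => v - L n)).
    - apply filterlim_const.
    - assert (Hprod := filterlim_comp_2 (fun h => h) (fun h => (v - L n) / h) Rmult Hid Hd
        (filterlim_mult (K := R_AbsRing) 0 (1 * l + -1 * (n * l')))).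
      change (mult 0 (1 * l + -1 * (n * l'))) with (0 * (1 * l + -1 * (n * l'))) in Hprod.
      rewrite Rmult_0_l in Hprod.
      eapply filterlim_ext_loc; [|exact Hprod].
      revert Hev. apply filter_imp. intros h Hh.
      change (h * ((v - L n) / h) = v - L n). field. lra. }
  split; [lra|].
  assert (1 * l + -1 * (n * l') = 0); [|lra].
  apply (filterlim_locally_unique (F := at_right 0) (fun h => (v - L n) / h)); [exact Hd|].
  eapply filterlim_ext; [|apply filterlim_const].
  intros h. simpl. rewrite Hv. unfold Rdiv. ring.
Qed.

(** Contraction towards the centre by [1 - h] sends the closed rectangle, corners included, into the
    open one; then let [h] tend to 0. *)
Lemma vanishing_on_closed_rect (a : R) (s : R -> R -> R) :
  0 < a ->
  continuous_on (closed_rect a) (fun p : R * R => s (fst p) (snd p)) ->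
  (forall x y, -1 < x < 1 -> -a < y < a -> s x y = 0) ->
  forall x y, closed_rect a (x, y) -> s x y = 0.
Proof.
  intros Ha Hc H0 x y Hxy.
  assert (Hxy' := Hxy). destruct Hxy' as [Hx Hy]; simpl in Hx, Hy.
  assert (Hray : forall t, filterlim (fun h => (1 - h) * t) (at_right 0) (locally t)).
  { intros t. eapply filterlim_filter_le_1; [apply filter_le_within|].
    assert (Hcont : continuous (fun h => (1 - h) * t) 0).
    { apply (ex_derive_continuous (fun h => (1 - h) * t)). auto_derive. easy. }
    unfold continuous in Hcont. now replace ((1 - 0) * t) with t in Hcont by ring. }
  assert (Hev : at_right 0 (fun h => 0 < h < 1)).
  { apply at_right_0_intro with 1; [lra|]. now intros h Hh. }
  assert (Hin : forall t b h, 0 < b -> 0 < h < 1 -> -b <= t <= b -> -b < (1 - h) * t < b).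
  { intros t b h Hb Hh Ht. nra. }
  apply (filterlim_locally_unique (F := at_right 0) (fun h => s ((1 - h) * x) ((1 - h) * y))).
  - apply (filterlim_comp _ _ _ (fun h => ((1 - h) * x, (1 - h) * y))
      (fun p : R * R => s (fst p) (snd p)) (at_right 0) (within (closed_rect a) (locally (x, y)))).
    + intros P [d HP].
      assert (H1 := Hray x _ (locally_ball x d)). assert (H2 := Hray y _ (locally_ball y d)).
      unfold filtermap in *. generalize (filter_and _ _ Hev (filter_and _ _ H1 H2)).
      apply filter_imp. intros h [Hh [Hb1 Hb2]]. apply HP; [now split|].
      assert (I1 := Hin x 1 h Rlt_0_1 Hh ltac:(lra)). assert (I2 := Hin y a h Ha Hh Hy).
      split; simpl; lra.
    + exact (Hc (x, y) Hxy).
  - eapply filterlim_ext_loc; [|apply filterlim_const].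
    revert Hev. apply filter_imp. intros h Hh. symmetry. apply H0.
    + apply Hin; lra.
    + apply Hin; lra.
Qed.

(** After separation [s] is determined by [f x = s x 0], a combination of [e] and [o]. By parity the
    Robin conditions at the two ends decouple, and the two nonvanishing hypotheses exclude the even
    and the odd part. *)
Lemma not_steklov_eigenvalue (a tau nu kappa : R) (c c1 e o : R -> R) :
  0 < a <= 1 -> profile_data a tau nu kappa c c1 ->
  (forall u, is_derive e u (- kappa * o u)) -> (forall u, is_derive o u (e u)) ->
  (forall u, e u ^ 2 + kappa * o u ^ 2 = 1) -> e (-1) = e 1 -> o (-1) = - o 1 ->
  kappa * o 1 + tau * e 1 <> 0 -> e 1 - tau * o 1 <> 0 ->
  ~ steklov_eigenvalue a tau.
Proof.
  intros Ha Hdata He Ho Heo Hem Hom Hne Hno [s Hs0].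
  assert (Hs := steklov_eigenfunction_solution a tau s Hs0).
  destruct (profile_bounds _ _ _ _ _ _ Hdata) as [c0 [C0 [Hc0 Hcb]]].
  assert (Hc00 : 0 < c 0) by (assert (H := Hcb 0 ltac:(lra)); lra).
  assert (Hsep : forall x y, -1 < x < 1 -> -a < y < a -> s x y = s x 0 / c 0 * c y).
  { intros x y Hx Hy.
    assert (H := steklov_solution_separates a tau nu kappa s c c1 x y 0 Ha Hdata Hs Hx Hy ltac:(lra)).
    apply (Rmult_eq_reg_r (c 0)); [|lra]. rewrite H. field. lra. }
  set (f := fun x => s x 0).
  assert (Hso : forall x, -1 < x < 1 -> exists p, second_order_at f x p (- kappa * f x)).
  { intros x Hx.
    destruct (solution_harmonic _ _ _ Hs x 0) as [p [pxx [q [qyy [H1 [H2 H3]]]]]].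
    { split; simpl; lra. }
    exists p. replace (- kappa * f x) with pxx; [exact H1|].
    (* The vertical slice is a multiple of [c], so its second derivative is [kappa] times its value;
       harmonicity turns this into the equation for [f]. *)
    assert (Hq : qyy = s x 0 / c 0 * (kappa * c 0)).
    { eapply second_order_unique_loc; [|exact H2|].
      2: { apply (second_order_scal (s x 0 / c 0)).
           apply (second_order_of_ode c c1); apply Hdata. }
      apply locally_intro with a; [lra|]. intros u Hu. apply Hsep; lra. }
    replace (s x 0 / c 0 * (kappa * c 0)) with (kappa * s x 0) in Hq by (field; lra).
    unfold f. lra. }
  destruct (ode_solution f (Derive f) e o kappa) as [A [B HAB]]; auto.
  { intros u Hu. destruct (Hso u Hu) as [p [g [Hg [Hgp Hg2]]]].
    split.
    - apply Derive_correct. eexists. exact (locally_singleton _ _ Hg).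
    - apply (is_derive_ext_loc g); [|exact Hg2].
      revert Hg. apply filter_imp. intros v Hv. symmetry. now apply is_derive_unique. }
  set (L := fun x => A * e x + B * o x).
  assert (HL : forall u, is_derive L u (A * (- kappa * o u) + B * e u)).
  { intros u.
    apply (is_derive_plus (fun v => A * e v) (fun v => B * o v)).
    - apply (is_derive_scal e), He.
    - apply (is_derive_scal o), Ho. }
  assert (Hend : forall n, n = 1 \/ n = -1 ->
    tau * L n = n * (A * (- kappa * o n) + B * e n)).
  { intros n Hn.
    assert (Hnorm : outward_normal a n 0 n 0).
    { destruct Hn as [->| ->]; constructor; lra. }
    assert (Hlim := solution_boundary _ _ _ Hs n 0 n 0 Hnorm).
    assert (Hvd : f n = L n /\ tau * f n = n * (A * (- kappa * o n) + B * e n)).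
    { apply (one_sided_derivative_of_extension f L n); [| |apply HL].
      - eapply filterlim_ext; [|exact Hlim].
        intros h. simpl. unfold f. rewrite Rmult_0_r, Rminus_0_r. reflexivity.
      - intros h Hh. apply HAB. destruct Hn as [->| ->]; lra. }
    destruct Hvd as [Hv Hd]. rewrite <- Hv. exact Hd. }
  assert (E1 := Hend 1 ltac:(now left)). assert (E2 := Hend (-1) ltac:(now right)).
  unfold L in E1, E2. rewrite Hem, Hom in E2.
  (* The sum of [E1] and [E2] involves only [A], their difference only [B]. *)
  assert (HA : A = 0).
  { apply (Rmult_eq_reg_r (kappa * o 1 + tau * e 1)); [lra|easy]. }
  assert (HB : B = 0).
  { apply (Rmult_eq_reg_r (e 1 - tau * o 1)); [lra|easy]. }
  destruct (steklov_nonzero _ _ _ Hs0) as [x [y [Hxy Hne0]]].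
  apply Hne0. apply (vanishing_on_closed_rect a); auto; [lra|apply Hs|].
  intros x' y' Hx' Hy'. rewrite (Hsep x' y' Hx' Hy').
  change (s x' 0) with (f x'). rewrite (HAB x' Hx'), HA, HB. unfold Rdiv. ring.
Qed.

(** * The spectrum below sigma_1 *)

Lemma continuity_of_ex_derive (f : R -> R) : (forall x, ex_derive f x) -> continuity f.
Proof.
  intros H x. apply continuity_pt_filterlim. apply (ex_derive_continuous f x), H.
Qed.

Lemma sinh_minus (x y : R) : sinh (x - y) = sinh x * cosh y - cosh x * sinh y.
Proof.
  unfold sinh, cosh, Rminus. rewrite Ropp_plus_distr, Ropp_involutive, !exp_plus. field.
Qed.

Lemma sinh_nonneg (x : R) : 0 <= x -> 0 <= sinh x.
Proof.
  intros [H| <-]; [|rewrite sinh_0; lra]. rewrite <- sinh_0. now apply Rlt_le, sinh_lt.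
Qed.

Lemma sinh_pos (x : R) : 0 < x -> 0 < sinh x.
Proof. intros H. rewrite <- sinh_0. now apply sinh_lt. Qed.

Lemma cosh_pos (x : R) : 0 < cosh x.
Proof. assert (H := cosh_ge_1 x). lra. Qed.

(** The form without denominators is continuous in [t], so the intermediate value theorem applies to
    it. *)
Lemma tan_eq_coth_iff (a t : R) :
  0 < a -> 0 < t -> cos t <> 0 ->
  tan t = coth (t * a) <-> sin t * sinh (t * a) = cos t * cosh (t * a).
Proof.
  intros Ha Ht Hc. assert (Hs : 0 < sinh (t * a)) by now apply sinh_pos, Rmult_lt_0_compat.
  unfold tan, coth. split; intros H.
  - replace (sin t) with (sin t / cos t * cos t) by (field; easy). rewrite H. field. lra.
  - apply (Rmult_eq_reg_r (cos t * sinh (t * a))).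
    + field_simplify; [lra|lra|easy].
    + apply Rmult_integral_contrapositive; split; lra.
Qed.

(** The difference of the two sides is [-1] at 0 and [sinh (PI / 2 * a) > 0] at [PI / 2], so there
    is a root in between, and minimality puts [nu] at or below it. *)
Lemma smallest_positive_solution_spec (a nu : R) :
  0 < a -> smallest_positive_solution a nu ->
  0 < nu < PI / 2 /\ sin nu * sinh (nu * a) = cos nu * cosh (nu * a).
Proof.
  intros Ha [[Hnu [Hc Htan]] Hmin]. apply tan_eq_coth_iff in Htan; auto.
  assert (HPI := PI_RGT_0).
  split; [|exact Htan]. split; [easy|].
  set (h := fun t => sin t * sinh (t * a) - cos t * cosh (t * a)).
  destruct (IVT h 0 (PI / 2)) as [t [Ht Hht]].
  - apply continuity_of_ex_derive. intros x. unfold h.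
    assert (ex_derive sinh (x * a)) by (eexists; apply is_derive_sinh).
    assert (ex_derive cosh (x * a)) by (eexists; apply is_derive_cosh).
    auto_derive. tauto.
  - lra.
  - unfold h. rewrite Rmult_0_l, sinh_0, cos_0, cosh_0. lra.
  - unfold h. rewrite sin_PI2, cos_PI2.
    assert (0 < sinh (PI / 2 * a)) by (apply sinh_pos, Rmult_lt_0_compat; lra). lra.
  - assert (Ht0 : t <> 0).
    { intros ->. unfold h in Hht. rewrite Rmult_0_l, sinh_0, cos_0, cosh_0 in Hht. lra. }
    assert (Ht1 : t <> PI / 2).
    { intros ->. unfold h in Hht. rewrite sin_PI2, cos_PI2 in Hht.
      assert (0 < sinh (PI / 2 * a)) by (apply sinh_pos, Rmult_lt_0_compat; lra). lra. }
    assert (Hcos : cos t <> 0) by (apply Rgt_not_eq, cos_gt_0; lra).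
    assert (Hle : nu <= t); [|lra].
    apply Hmin. split; [lra|]. split; [easy|].
    apply tan_eq_coth_iff; auto; [lra|]. unfold h in Hht. lra.
Qed.

Lemma sin_pos_first_quadrant (x : R) : 0 < x < PI / 2 -> 0 < sin x.
Proof. intros H. assert (HP := PI_RGT_0). apply sin_gt_0; lra. Qed.

(** The equation for [nu] gives the eigenvalue a second expression, [nu cot nu], which is the one
    forced by the vertical sides. *)
Lemma sigma_sin (a nu : R) :
  sin nu * sinh (nu * a) = cos nu * cosh (nu * a) ->
  nu * tanh (nu * a) * sin nu = nu * cos nu.
Proof.
  intros H. assert (Hc := cosh_pos (nu * a)). unfold tanh.
  replace (nu * (sinh (nu * a) / cosh (nu * a)) * sin nu)
    with (nu * (sin nu * sinh (nu * a)) / cosh (nu * a)) by (field; lra).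
  rewrite H. field. lra.
Qed.

(** Both expressions of [sigma] are used: for [a <= 1], [nu tanh (nu a) <= nu tanh nu] and
    [nu cot nu <= nu cot (nu a)]. The signs of [sinh (nu - nu a)] and [sin (nu - nu a)] express this
    without division. *)
Lemma comparison_conditions (a nu tau : R) :
  0 < a <= 1 -> 0 < nu < PI / 2 ->
  sin nu * sinh (nu * a) = cos nu * cosh (nu * a) ->
  tau < nu * tanh (nu * a) ->
  tau * cosh nu < nu * sinh nu /\ tau * sin (nu * a) < nu * cos (nu * a).
Proof.
  intros Ha Hnu Heq Htau.
  assert (HPI := PI_RGT_0).
  assert (Hsig := sigma_sin a nu Heq).
  set (sigma := nu * tanh (nu * a)) in *.
  assert (Hsc : sigma * cosh (nu * a) = nu * sinh (nu * a)).
  { unfold sigma, tanh. assert (H := cosh_pos (nu * a)). field. lra. }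
  assert (Hna : 0 < nu * a <= nu) by nra.
  assert (Hsin := sin_pos_first_quadrant nu Hnu).
  assert (Hsina := sin_pos_first_quadrant (nu * a) ltac:(lra)).
  split.
  - apply Rlt_le_trans with (sigma * cosh nu).
    + apply Rmult_lt_compat_r; [apply cosh_pos|easy].
    + assert (H := sinh_nonneg (nu - nu * a) ltac:(lra)). rewrite sinh_minus in H.
      apply (Rmult_le_reg_r (cosh (nu * a))); [apply cosh_pos|].
      replace (sigma * cosh nu * cosh (nu * a)) with (cosh nu * (nu * sinh (nu * a)))
        by (rewrite <- Hsc; ring).
      assert (0 <= nu * (sinh nu * cosh (nu * a) - cosh nu * sinh (nu * a)))
        by (apply Rmult_le_pos; lra).
      lra.
  - apply Rlt_le_trans with (sigma * sin (nu * a)).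
    + now apply Rmult_lt_compat_r.
    + assert (H : 0 <= sin (nu - nu * a)) by (apply sin_ge_0; lra). rewrite sin_minus in H.
      apply (Rmult_le_reg_r (sin nu)); [easy|].
      replace (sigma * sin (nu * a) * sin nu) with (sin (nu * a) * (nu * cos nu))
        by (rewrite <- Hsig; ring).
      assert (0 <= nu * (sin nu * cos (nu * a) - cos nu * sin (nu * a)))
        by (apply Rmult_le_pos; lra).
      lra.
Qed.

(** The claim is that [sin (nu u) / c u] is nondecreasing. The numerator of its derivative is even
    in [u], so its sign on [[0, a]] decides. *)
Lemma sin_over_profile_mono (a nu : R) (c c1 : R -> R) :
  (forall u, is_derive c u (c1 u)) ->
  (forall u, -a <= u <= a -> 0 < c u) ->
  (forall u, c (- u) = c u) -> (forall u, c1 (- u) = - c1 u) ->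
  (forall u, 0 <= u <= a -> sin (nu * u) * c1 u <= nu * cos (nu * u) * c u) ->
  forall y z, -a <= z <= y -> y <= a -> sin (nu * z) * c y <= sin (nu * y) * c z.
Proof.
  intros Hc Hpos Hev Hodd HW y z Hz Hy.
  assert (HW' : forall u, -a <= u <= a -> sin (nu * u) * c1 u <= nu * cos (nu * u) * c u).
  { intros u Hu. destruct (Rle_dec 0 u) as [H|H]; [apply HW; lra|].
    assert (H1 := HW (- u) ltac:(lra)). rewrite Hev, Hodd in H1.
    replace (nu * - u) with (- (nu * u)) in H1 by ring. rewrite sin_neg, cos_neg in H1. lra. }
  destruct (proj2 Hz) as [Hlt| ->]; [|lra].
  destruct (MVT_cor2 (fun u => sin (nu * u) / c u)
    (fun u => (nu * cos (nu * u) * c u - sin (nu * u) * c1 u) / (c u) ^ 2) z y Hlt) as [w [Hw Hzw]].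
  - intros u Hu. apply is_derive_Reals.
    assert (Hcu := Hpos u ltac:(lra)). evar_last.
    + auto_derive; [|reflexivity].
      assert (ex_derive c u) by (eexists; apply Hc). repeat split; auto. lra.
    + rewrite (Derive_eta _ _ _ (Hc u)). field. lra.
  - assert (Hcy := Hpos y ltac:(lra)). assert (Hcz := Hpos z ltac:(lra)).
    assert (Hcw := Hpos w ltac:(lra)). assert (HWw := HW' w ltac:(lra)).
    assert (Hd : 0 <= (nu * cos (nu * w) * c w - sin (nu * w) * c1 w) / c w ^ 2 * (y - z)).
    { apply Rmult_le_pos; [|lra]. apply Rdiv_le_0_compat; [lra|nra]. }
    rewrite <- Hw in Hd.
    assert (H : 0 <= (sin (nu * y) / c y - sin (nu * z) / c z) * (c y * c z)).
    { apply Rmult_le_pos; [easy|]. apply Rmult_le_pos; lra. }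
    replace ((sin (nu * y) / c y - sin (nu * z) / c z) * (c y * c z))
      with (sin (nu * y) * c z - sin (nu * z) * c y) in H by (field; lra).
    lra.
Qed.

Lemma not_steklov_eigenvalue_pos (a nu tau : R) :
  0 < a <= 1 -> smallest_positive_solution a nu ->
  0 < tau < nu * tanh (nu * a) -> ~ steklov_eigenvalue a tau.
Proof.
  intros Ha Hsm Htau.
  destruct (smallest_positive_solution_spec a nu (proj1 Ha) Hsm) as [Hnu Heq].
  destruct (comparison_conditions a nu tau Ha Hnu Heq (proj2 Htau)) as [F1 F2].
  assert (HPI := PI_RGT_0).
  (* A root means [k tanh (k a) = tau], the Robin condition for [cosh (k y)]; the sign at [nu] is
     that of [nu tanh (nu a) - tau]. *)
  set (h := fun k => k * sinh (k * a) - tau * cosh (k * a)).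
  assert (Hh0 : h 0 < 0) by (unfold h; rewrite !Rmult_0_l, cosh_0; lra).
  assert (Hh1 : 0 < h nu).
  { unfold h. assert (H := cosh_pos (nu * a)).
    replace (nu * sinh (nu * a)) with (nu * tanh (nu * a) * cosh (nu * a))
      by (unfold tanh; field; lra).
    assert (tau * cosh (nu * a) < nu * tanh (nu * a) * cosh (nu * a))
      by now apply Rmult_lt_compat_r.
    lra. }
  destruct (IVT h 0 nu) as [k [Hk Hhk]]; auto; [|lra|].
  { apply continuity_of_ex_derive. intros x. unfold h.
    assert (ex_derive sinh (x * a)) by (eexists; apply is_derive_sinh).
    assert (ex_derive cosh (x * a)) by (eexists; apply is_derive_cosh).
    auto_derive. tauto. }
  assert (Hk0 : k <> 0) by (intros ->; lra). assert (Hk1 : k <> nu) by (intros ->; lra).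
  assert (Hkk : k * sinh (k * a) = tau * cosh (k * a)) by (unfold h in Hhk; lra).
  assert (Hkpos : 0 < k < PI / 2) by lra.
  assert (Hsin := sin_pos_first_quadrant k Hkpos).
  assert (Hcos : 0 < cos k) by (apply cos_gt_0; lra).
  assert (Dc : forall u, is_derive (fun u => cosh (k * u)) u (k * sinh (k * u))).
  { intros u. apply is_derive_comp_scal, is_derive_cosh. }
  apply (not_steklov_eigenvalue a tau nu (k ^ 2) (fun u => cosh (k * u)) (fun u => k * sinh (k * u))
    (fun u => cos (k * u)) (fun u => sin (k * u) / k)).
  - exact Ha.
  - constructor; auto.
    (* Here [2 a^2 nu^2 < PI^2 / 2] already, and subtracting [k^2] only helps. *)
    + assert (a ^ 2 <= 1) by nra. assert (nu ^ 2 < (PI / 2) ^ 2) by nra.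
      assert (0 <= a ^ 2) by nra. assert (0 < k ^ 2) by nra.
      destruct (Rle_dec 0 (nu ^ 2 - k ^ 2)) as [H'|H']; nra.
    + intros u. replace (k ^ 2 * cosh (k * u)) with (k * (k * cosh (k * u))) by ring.
      apply (is_derive_scal (fun u => sinh (k * u))), is_derive_comp_scal, is_derive_sinh.
    + replace (k * - a) with (- (k * a)) by ring. rewrite sinh_opp, cosh_opp. lra.
    + exists 1, (exp (k * a)). split; [lra|]. intros u Hu. split; [apply cosh_ge_1|].
      assert (Hexp : forall v, v <= k * a -> exp v <= exp (k * a)).
      { intros v [Hv| ->]; [now apply Rlt_le, exp_increasing|lra]. }
      assert (k * u <= k * a) by nra. assert (- (k * u) <= k * a) by nra.
      assert (H1 := Hexp (k * u) ltac:(easy)). assert (H2 := Hexp (- (k * u)) ltac:(easy)).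
      unfold cosh. lra.
    + apply (sin_over_profile_mono a nu _ (fun u => k * sinh (k * u))); auto.
      * intros u _. apply cosh_pos.
      * intros u. replace (k * - u) with (- (k * u)) by ring. apply cosh_opp.
      * intros u. replace (k * - u) with (- (k * u)) by ring. rewrite sinh_opp. ring.
      * intros u Hu.
        assert (Hna : 0 < nu * a <= nu) by nra. assert (Hnu' : 0 <= nu * u <= nu * a) by nra.
        assert (Hsu : 0 <= sin (nu * u)) by (apply sin_ge_0; lra).
        assert (Hsua : sin (nu * u) <= sin (nu * a)) by (apply sin_incr_1; lra).
        assert (Hcua : cos (nu * a) <= cos (nu * u)) by (apply cos_decr_1; lra).
        (* The logarithmic derivative [k tanh (k u)] of the profile is largest at [a], where it
           equals [tau]; that of [sin (nu u)] is smallest there and still exceeds [tau]. *)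
        assert (Hks : k * sinh (k * u) <= tau * cosh (k * u)).
        { assert (H := sinh_nonneg (k * a - k * u) ltac:(nra)). rewrite sinh_minus in H.
          apply (Rmult_le_reg_r (cosh (k * a))); [apply cosh_pos|].
          replace (tau * cosh (k * u) * cosh (k * a)) with (cosh (k * u) * (k * sinh (k * a)))
            by (rewrite Hkk; ring).
          assert (0 <= k * (sinh (k * a) * cosh (k * u) - cosh (k * a) * sinh (k * u)))
            by (apply Rmult_le_pos; lra).
          lra. }
        assert (Hch := cosh_pos (k * u)).
        apply Rle_trans with (sin (nu * u) * (tau * cosh (k * u))); [now apply Rmult_le_compat_l|].
        assert (tau * sin (nu * u) <= tau * sin (nu * a)) by (apply Rmult_le_compat_l; lra).
        assert (nu * cos (nu * a) <= nu * cos (nu * u)) by (apply Rmult_le_compat_l; lra).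
        assert (tau * sin (nu * u) * cosh (k * u) <= nu * cos (nu * u) * cosh (k * u))
          by (apply Rmult_le_compat_r; lra).
        lra.
  - intros u. auto_derive; [easy|]. field. lra.
  - intros u. auto_derive; [easy|]. field. lra.
  - intros u. assert (H := sin2_cos2 (k * u)). unfold Rsqr in H.
    replace (cos (k * u) ^ 2 + k ^ 2 * (sin (k * u) / k) ^ 2)
      with (sin (k * u) * sin (k * u) + cos (k * u) * cos (k * u)) by (field; lra). exact H.
  - cbv beta. replace (k * -1) with (- (k * 1)) by ring. apply cos_neg.
  - cbv beta. replace (k * -1) with (- (k * 1)) by ring. rewrite sin_neg. field. lra.
  - cbv beta. rewrite Rmult_1_r. apply Rgt_not_eq.
    replace (k ^ 2 * (sin k / k)) with (k * sin k) by (field; lra).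
    assert (0 < k * sin k) by (apply Rmult_lt_0_compat; lra).
    assert (0 < tau * cos k) by (apply Rmult_lt_0_compat; lra). lra.
  - cbv beta. rewrite Rmult_1_r. intros H0.
    assert (H1 : k * cos k = tau * sin k).
    { replace (k * cos k) with (k * (cos k - tau * (sin k / k)) + tau * sin k) by (field; lra).
      rewrite H0. ring. }
    (* An odd solution would satisfy [k cot k = tau = k tanh (k a)], that is [tan k = coth (k a)]
       with [k < nu], against minimality. *)
    assert (Hps : positive_solution a k).
    { split; [lra|]. split; [lra|]. apply tan_eq_coth_iff; [lra|lra|lra|].
      apply (Rmult_eq_reg_l k); [|lra].
      replace (k * (sin k * sinh (k * a))) with (sin k * (k * sinh (k * a))) by ring.
      rewrite Hkk. replace (k * (cos k * cosh (k * a))) with (k * cos k * cosh (k * a)) by ring.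
      rewrite H1. ring. }
    apply (proj2 Hsm) in Hps. lra.
Qed.

Lemma not_steklov_eigenvalue_neg (a nu tau : R) :
  0 < a <= 1 -> smallest_positive_solution a nu -> tau < 0 -> ~ steklov_eigenvalue a tau.
Proof.
  intros Ha Hsm Htau.
  destruct (smallest_positive_solution_spec a nu (proj1 Ha) Hsm) as [Hnu Heq].
  assert (Hsig : 0 < nu * tanh (nu * a)).
  { apply Rmult_lt_0_compat; [lra|]. apply Rdiv_lt_0_compat; [|apply cosh_pos].
    apply sinh_pos, Rmult_lt_0_compat; lra. }
  destruct (comparison_conditions a nu tau Ha Hnu Heq ltac:(lra)) as [F1 F2].
  assert (HPI := PI_RGT_0).
  (* The Robin condition for [cos (k y)]. The root found satisfies [k a < PI / 2], so the profile
     stays positive on [[-a, a]]. *)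
  set (h := fun k => k * sin (k * a) + tau * cos (k * a)).
  set (k1 := PI / (2 * a)).
  assert (Hk1a : k1 * a = PI / 2) by (unfold k1; field; lra).
  assert (Hk1 : 0 < k1) by (apply Rdiv_lt_0_compat; lra).
  assert (Hh0 : h 0 < 0) by (unfold h; rewrite !Rmult_0_l, cos_0; lra).
  assert (Hh1 : 0 < h k1) by (unfold h; rewrite Hk1a, sin_PI2, cos_PI2; lra).
  destruct (IVT h 0 k1) as [k [Hk Hhk]]; auto.
  { apply continuity_of_ex_derive. intros x. unfold h. auto_derive. easy. }
  assert (Hk0 : k <> 0) by (intros ->; lra). assert (Hkk1 : k <> k1) by (intros ->; lra).
  assert (Hka : 0 < k * a < PI / 2) by (rewrite <- Hk1a; nra).
  assert (Hkk : - (k * sin (k * a)) = tau * cos (k * a)) by (unfold h in Hhk; lra).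
  assert (Hcka : 0 < cos (k * a)) by (apply cos_gt_0; lra).
  assert (Hcu : forall u, -a <= u <= a -> cos (k * a) <= cos (k * u)).
  { intros u Hu. destruct (Rle_dec 0 u) as [H|H].
    - apply cos_decr_1; nra.
    - rewrite <- (cos_neg (k * u)). apply cos_decr_1; nra. }
  apply (not_steklov_eigenvalue a tau nu (- k ^ 2) (fun u => cos (k * u))
    (fun u => - (k * sin (k * u))) (fun u => cosh (k * u)) (fun u => sinh (k * u) / k)).
  - exact Ha.
  - constructor; auto.
    (* Both [nu a] and [k a] lie below [PI / 2], so the two squares add up to just under the
       threshold [PI^2]. *)
    + assert (0 < nu * a < PI / 2) by nra.
      replace (2 * a ^ 2 * (nu ^ 2 - - k ^ 2)) with (2 * (nu * a) ^ 2 + 2 * (k * a) ^ 2) by ring.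
      nra.
    + intros u. auto_derive; [easy|]. ring.
    + intros u. auto_derive; [easy|]. ring.
    + replace (k * - a) with (- (k * a)) by ring. rewrite sin_neg, cos_neg. lra.
    + exists (cos (k * a)), 1. split; [easy|]. intros u Hu. split; [now apply Hcu|apply COS_bound].
    + apply (sin_over_profile_mono a nu _ (fun u => - (k * sin (k * u)))).
      * intros u. auto_derive; [easy|]. ring.
      * intros u Hu. assert (H := Hcu u Hu). lra.
      * intros u. replace (k * - u) with (- (k * u)) by ring. apply cos_neg.
      * intros u. replace (k * - u) with (- (k * u)) by ring. rewrite sin_neg. ring.
      * intros u Hu.
        assert (Hna : 0 < nu * a <= nu) by nra. assert (Hnu' : 0 <= nu * u <= nu * a) by nra.
        assert (Hku : 0 <= k * u <= k * a) by nra.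
        assert (0 <= sin (nu * u)) by (apply sin_ge_0; lra).
        assert (0 <= sin (k * u)) by (apply sin_ge_0; lra).
        assert (0 <= cos (nu * u)) by (apply cos_ge_0; lra).
        assert (0 <= cos (k * u)) by (apply cos_ge_0; lra).
        assert (0 <= sin (nu * u) * (k * sin (k * u))).
        { apply Rmult_le_pos; [easy|]. apply Rmult_le_pos; lra. }
        assert (0 <= nu * cos (nu * u) * cos (k * u)).
        { apply Rmult_le_pos; [|easy]. apply Rmult_le_pos; lra. }
        lra.
  - intros u. replace (- - k ^ 2 * (sinh (k * u) / k)) with (k * sinh (k * u)) by (field; lra).
    apply is_derive_comp_scal, is_derive_cosh.
  - intros u. apply (is_derive_ext (fun u => / k * sinh (k * u))).
    { intros t. apply Rmult_comm. }
    replace (cosh (k * u)) with (/ k * (k * cosh (k * u))) by (field; lra).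
    apply (is_derive_scal (fun u => sinh (k * u))), is_derive_comp_scal, is_derive_sinh.
  - intros u. replace (cosh (k * u) ^ 2 + - k ^ 2 * (sinh (k * u) / k) ^ 2)
      with (cosh (k * u) ^ 2 - sinh (k * u) ^ 2) by (field; lra).
    unfold cosh, sinh.
    assert (exp (k * u) * exp (- (k * u)) = 1) by (rewrite <- exp_plus, Rplus_opp_r; apply exp_0).
    lra.
  - cbv beta. replace (k * -1) with (- (k * 1)) by ring. apply cosh_opp.
  - cbv beta. replace (k * -1) with (- (k * 1)) by ring. rewrite sinh_opp. field. lra.
  - cbv beta. rewrite Rmult_1_r. apply Rlt_not_eq.
    replace (- k ^ 2 * (sinh k / k)) with (- (k * sinh k)) by (field; lra).
    assert (H1 := sinh_pos k ltac:(lra)). assert (H2 := cosh_pos k).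
    assert (0 < k * sinh k) by (apply Rmult_lt_0_compat; lra).
    assert (0 < - tau * cosh k) by (apply Rmult_lt_0_compat; lra). lra.
  - cbv beta. rewrite Rmult_1_r. apply Rgt_not_eq.
    assert (H1 := sinh_pos k ltac:(lra)). assert (H2 := cosh_pos k).
    assert (0 < sinh k / k) by (apply Rdiv_lt_0_compat; lra).
    assert (0 < - tau * (sinh k / k)) by (apply Rmult_lt_0_compat; lra). lra.
Qed.

(** * The eigenfunction for the value [nu * tanh (nu * a)] *)

Definition wave (nu p q p' q' x y : R) : R :=
  (p * sin (nu * x) + q * cos (nu * x)) * (p' * cosh (nu * y) + q' * sinh (nu * y)).

Lemma is_derive_wave_x (nu p q p' q' x y : R) :
  is_derive (fun t => wave nu p q p' q' t y) x (wave nu (- nu * q) (nu * p) p' q' x y).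
Proof. unfold wave. auto_derive; [easy|]. ring. Qed.

Lemma is_derive_wave_y (nu p q p' q' x y : R) :
  is_derive (fun t => wave nu p q p' q' x t) y (wave nu p q (nu * q') (nu * p') x y).
Proof.
  unfold wave.
  assert (H1 := is_derive_comp_scal cosh nu y _ (is_derive_cosh (nu * y))).
  assert (H2 := is_derive_comp_scal sinh nu y _ (is_derive_sinh (nu * y))).
  replace ((p * sin (nu * x) + q * cos (nu * x)) *
    (nu * q' * cosh (nu * y) + nu * p' * sinh (nu * y)))
    with ((p * sin (nu * x) + q * cos (nu * x)) *
      (p' * (nu * sinh (nu * y)) + q' * (nu * cosh (nu * y)))) by ring.
  apply (is_derive_scal (fun t => p' * cosh (nu * t) + q' * sinh (nu * t))).
  apply (is_derive_plus (fun t => p' * cosh (nu * t)) (fun t => q' * sinh (nu * t))).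
  - now apply (is_derive_scal (fun t => cosh (nu * t))).
  - now apply (is_derive_scal (fun t => sinh (nu * t))).
Qed.

Lemma continuous_wave (nu p q p' q' : R) (z : R * R) :
  continuous (fun z : R * R => wave nu p q p' q' (fst z) (snd z)) z.
Proof.
  unfold wave. apply continuous_Rmult.
  - apply (continuous_of_ex_derive (fun z : R * R => fst z)
      (fun t => p * sin (nu * t) + q * cos (nu * t))); [apply continuous_fst|auto_derive; easy].
  - apply (continuous_of_ex_derive (fun z : R * R => snd z)
      (fun t => p' * cosh (nu * t) + q' * sinh (nu * t))); [apply continuous_snd|].
    assert (H := is_derive_wave_y nu 0 1 p' q' 0 (snd z)). eexists.
    eapply is_derive_ext; [|exact H].
    intros t. unfold wave. rewrite Rmult_0_r, cos_0, Rmult_0_l, Rplus_0_l, Rmult_1_l, Rmult_1_l.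
    reflexivity.
Qed.

(** The family [wave] is closed under both partial derivatives, which act on the coefficients only;
    hence the induction over all coefficients at once. *)
Lemma ex_diff_n_wave (nu p q p' q' x y : R) (n : nat) :
  ex_diff_n (wave nu p q p' q') n x y.
Proof.
  revert p q p' q' x y.
  induction n as [|n IH]; intros p q p' q' x y.
  - split; [|easy]. apply continuity_2d_pt_filterlim. apply (continuous_wave nu p q p' q' (x, y)).
  - split; [|split; [|split; [|split]]].
    + apply continuity_2d_pt_filterlim. apply (continuous_wave nu p q p' q' (x, y)).
    + eexists. apply is_derive_wave_x.
    + eexists. apply is_derive_wave_y.
    + apply (ex_diff_n_ext_loc (wave nu (- nu * q) (nu * p) p' q')); [|apply IH].
      exists (mkposreal 1 Rlt_0_1). intros u v _ _. symmetry.
      apply is_derive_unique, is_derive_wave_x.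
    + apply (ex_diff_n_ext_loc (wave nu p q (nu * q') (nu * p'))); [|apply IH].
      exists (mkposreal 1 Rlt_0_1). intros u v _ _. symmetry.
      apply is_derive_unique, is_derive_wave_y.
Qed.

(** The ratio of normal derivative to value is [nu cot nu] on the vertical sides and
    [nu tanh (nu a)] on the horizontal ones; the equation for [nu] says that they agree. *)
Lemma wave_steklov_eigenfunction (a nu : R) :
  0 < a -> 0 < nu < PI / 2 -> sin nu * sinh (nu * a) = cos nu * cosh (nu * a) ->
  steklov_eigenfunction a (nu * tanh (nu * a)) (wave nu 1 0 1 0).
Proof.
  intros Ha Hnu Heq.
  assert (Hsig := sigma_sin a nu Heq).
  assert (Hsc : nu * tanh (nu * a) * cosh (nu * a) = nu * sinh (nu * a)).
  { unfold tanh. assert (H := cosh_pos (nu * a)). field. lra. }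
  constructor.
  - apply continuous_on_continuous. intros p _. apply continuous_wave.
  - intros x y nx ny _. split.
    + exists (wave nu (- nu * 0) (nu * 1) 1 0 x y).
      eapply filterlim_filter_le_1; [apply filter_le_within|].
      eapply filterlim_ext; [|apply (continuous_wave nu (- nu * 0) (nu * 1) 1 0 (x, y))].
      intros [u v]. symmetry. apply is_derive_unique, is_derive_wave_x.
    + exists (wave nu 1 0 (nu * 0) (nu * 1) x y).
      eapply filterlim_filter_le_1; [apply filter_le_within|].
      eapply filterlim_ext; [|apply (continuous_wave nu 1 0 (nu * 0) (nu * 1) (x, y))].
      intros [u v]. symmetry. apply is_derive_unique, is_derive_wave_y.
  - exists 1, 0. split; [split; simpl; lra|].
    unfold wave. rewrite Rmult_0_r, cosh_0, sinh_0, Rmult_1_r.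
    assert (H := sin_pos_first_quadrant nu Hnu). lra.
  - intros x y _. split; [apply ex_diff_n_wave|].
    unfold partial_derive. simpl.
    rewrite (Derive_ext (fun u => Derive (fun t => wave nu 1 0 1 0 t y) u)
      (fun u => wave nu (- nu * 0) (nu * 1) 1 0 u y)) by
      (intros u; apply is_derive_unique, is_derive_wave_x).
    rewrite (Derive_ext (fun u => Derive (fun t => wave nu 1 0 1 0 x t) u)
      (fun u => wave nu 1 0 (nu * 0) (nu * 1) x u)) by
      (intros u; apply is_derive_unique, is_derive_wave_y).
    rewrite (is_derive_unique _ _ _ (is_derive_wave_x _ _ _ _ _ _ _)).
    rewrite (is_derive_unique _ _ _ (is_derive_wave_y _ _ _ _ _ _ _)).
    unfold wave. ring.
  - assert (Hx := fun x y => left_quotient_is_derive _ x x _ (is_derive_wave_x nu 1 0 1 0 x y)).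
    assert (Hy := fun n x y => left_quotient_is_derive _ y n _ (is_derive_wave_y nu 1 0 1 0 x y)).
    assert (Hgx : forall x y, x = 1 \/ x = -1 -> is_normal_derivative (wave nu 1 0 1 0) x y x 0
      (nu * tanh (nu * a) * wave nu 1 0 1 0 x y)).
    { intros x y Hxx. unfold is_normal_derivative.
      replace (nu * tanh (nu * a) * wave nu 1 0 1 0 x y)
        with (x * wave nu (- nu * 0) (nu * 1) 1 0 x y).
      - eapply filterlim_ext; [|exact (Hx x y)].
        intros h. simpl. now rewrite Rmult_0_r, Rminus_0_r.
      - unfold wave. destruct Hxx as [->| ->].
        + rewrite Rmult_1_r. replace (nu * tanh (nu * a) * ((1 * sin nu + 0 * cos nu) *
            (1 * cosh (nu * y) + 0 * sinh (nu * y))))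
            with (nu * tanh (nu * a) * sin nu * cosh (nu * y)) by ring. rewrite Hsig. ring.
        + replace (nu * -1) with (- nu) by ring. rewrite sin_neg, cos_neg.
          replace (nu * tanh (nu * a) * ((1 * - sin nu + 0 * cos nu) *
            (1 * cosh (nu * y) + 0 * sinh (nu * y))))
            with (- (nu * tanh (nu * a) * sin nu * cosh (nu * y))) by ring. rewrite Hsig. ring. }
    intros x y nx ny Hn. destruct Hn as [y Hy'|y Hy'|x Hx'|x Hx'].
    + apply Hgx. now left.
    + apply Hgx. now right.
    + unfold is_normal_derivative.
      replace (nu * tanh (nu * a) * wave nu 1 0 1 0 x a)
        with (1 * wave nu 1 0 (nu * 0) (nu * 1) x a).
      * eapply filterlim_ext; [|exact (Hy 1 x a)].
        intros h. simpl. now rewrite Rmult_0_r, Rminus_0_r.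
      * unfold wave. replace (nu * tanh (nu * a) * ((1 * sin (nu * x) + 0 * cos (nu * x)) *
          (1 * cosh (nu * a) + 0 * sinh (nu * a))))
          with (nu * tanh (nu * a) * cosh (nu * a) * sin (nu * x)) by ring. rewrite Hsc. ring.
    + unfold is_normal_derivative.
      replace (nu * tanh (nu * a) * wave nu 1 0 1 0 x (- a))
        with (-1 * wave nu 1 0 (nu * 0) (nu * 1) x (- a)).
      * eapply filterlim_ext; [|exact (Hy (-1) x (- a))].
        intros h. simpl. now rewrite Rmult_0_r, Rminus_0_r.
      * unfold wave. replace (nu * - a) with (- (nu * a)) by ring. rewrite sinh_opp, cosh_opp.
        replace (nu * tanh (nu * a) * ((1 * sin (nu * x) + 0 * cos (nu * x)) *
          (1 * cosh (nu * a) + 0 * - sinh (nu * a))))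
          with (nu * tanh (nu * a) * cosh (nu * a) * sin (nu * x)) by ring. rewrite Hsc. ring.
Qed.

Theorem mainTheorem1 (a nu : R) (ha : 0 < a <= 1)
  (hnu : smallest_positive_solution a nu) :
  steklov_eigenfunction a (nu * tanh (nu * a))
    (fun x y => sin (nu * x) * cosh (nu * y)) /\
  is_first_nontrivial_steklov_eigenvalue a (nu * tanh (nu * a)).
Proof.
  destruct (smallest_positive_solution_spec a nu (proj1 ha) hnu) as [Hnu Heq].
  assert (Hwave := wave_steklov_eigenfunction a nu (proj1 ha) Hnu Heq).
  assert (E : wave nu 1 0 1 0 = fun x y => sin (nu * x) * cosh (nu * y)).
  { apply functional_extensionality; intros x. apply functional_extensionality; intros y.
    unfold wave. ring. }
  rewrite E in Hwave.
  assert (Hsig : 0 < nu * tanh (nu * a)).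
  { apply Rmult_lt_0_compat; [lra|]. apply Rdiv_lt_0_compat; [|apply cosh_pos].
    apply sinh_pos, Rmult_lt_0_compat; lra. }
  split; [exact Hwave|]. split; [eexists; exact Hwave|]. split; [lra|].
  intros tau Htau Htau0. apply Rnot_lt_le. intros Hlt.
  destruct (Rtotal_order tau 0) as [Hneg|[H0|Hpos]]; [|easy|].
  - now apply (not_steklov_eigenvalue_neg a nu tau).
  - now apply (not_steklov_eigenvalue_pos a nu tau).
Qed.
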